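(* Let $X=\left[-\tfrac12,\tfrac12\right)$ and $G=\frac{1+\sqrt5}{2}$. Let $\mu_N$ be the probability measure on $X$ with density $$\rho(x)=\begin{cases}\frac{1}{\log G}\,\frac{1}{G+x}, & x\in\left[0,\tfrac12\right),\\[2pt] \frac{1}{\log G}\,\frac{1}{G+1+x}, & x\in\left[-\tfrac12,0\right).\end{cases}$$ Let $T_N:X\to X$ be given by $T_N(x)=\frac{\epsilon}{x}-\left\lfloor \frac{\epsilon}{x}+\frac12\right\rfloor$ for $x\neq0$ (where $\epsilon=\operatorname{sgn}(x)$) and $T_N(0)=0$, and define the nearest integer continued fraction digits $b_1(x)=\left\lfloor \frac{\epsilon}{x}+\frac12\right\rfloor$ (with $\epsilon=\operatorname{sgn}(x)$) and $b_n(x)=b_1(T_N^{n-1}(x))$ (defined for $\mu_N$-almost every $x$). For $x\in X$ and $r\in\mathbb{R}$ let $S_n(x,r)=\#\{j\in\{1,\dots,n\}: b_j(x)>r\}$, and set $u_n(r)=\frac{nr}{\log G}$. Then for all $r>0$ and any $j\in\mathbb{N}$, $$\lim_{n\to\infty}\mu_N\{x\in X: S_n(x,u_n(r))=j\}=e^{-\frac1r}\,\frac{r^{-j}}{j!}.$$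
   Context: $\lfloor\cdot\rfloor$ denotes the floor function. Here $\mathbb{N}$ includes $0$ (the case $j=0$ is used in the paper). The measure $\mu_N$ is $T_N$-invariant. *)

(* Defs.v *)
From HB Require Import structures.
From mathcomp Require Import all_boot all_order all_algebra.
From mathcomp Require Import all_classical all_reals all_analysis.
From mathcomp Require Import measurable_realfun.
From mathcomp Require Import ring lra.

Set Implicit Arguments.
Unset Strict Implicit.
Unset Printing Implicit Defensive.

Import Order.TTheory GRing.Theory Num.Theory.
Import numFieldNormedType.Exports.

Local Open Scope classical_set_scope.
Local Open Scope ring_scope.

Definition golden (R : realType) : R := (1 + Num.sqrt 5) / 2.
Arguments golden {R}.

Definition X (R : realType) : set R := `[- (1 / 2), 1 / 2[%classic.
Arguments X {R}.

(* The measure lives on the whole of R, hence the value 0 outside X. *)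
Definition rho (R : realType) (x : R) : R :=
  if 0 <= x < 1 / 2 then 1 / ln golden * (1 / (golden + x))
  else if - (1 / 2) <= x < 0 then 1 / ln golden * (1 / (golden + 1 + x))
  else 0.

Definition muN (R : realType) : set R -> \bar R :=
  fun A => (\int[lebesgue_measure]_(x in A) (rho x)%:E)%E.
Arguments muN {R}.

Definition TN (R : realType) (x : R) : R :=
  if x == 0 then 0
  else Num.sg x / x - (Num.floor (Num.sg x / x + 1 / 2))%:~R.

(* Undefined at 0 mathematically; here the value is 0, since 0 / 0 = 0. *)
Definition b1 (R : realType) (x : R) : int :=
  Num.floor (Num.sg x / x + 1 / 2).

Definition bn (R : realType) (n : nat) (x : R) : int := b1 (iter n.-1 (@TN R) x).

Definition Sn (R : realType) (n : nat) (x r : R) : nat :=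
  count (fun j => r < (bn j x)%:~R) (iota 1 n).

Definition un (R : realType) (n : nat) (r : R) : R := n%:R * r / ln golden.

Lemma golden_gt1 (R : realType) : 1 < golden :> R.
Proof.
have : 1 < Num.sqrt 5 :> R by rewrite -[ltLHS]sqrtr1 ltr_sqrt//; lra.
rewrite /golden; lra.
Qed.

Lemma golden_sqr (R : realType) : golden ^+ 2 = golden + 1 :> R.
Proof.
have : Num.sqrt 5 ^+ 2 = 5 :> R by rewrite sqr_sqrtr.
by rewrite /golden => h; field: h.
Qed.

Lemma ln_golden_gt0 (R : realType) : 0 < ln golden :> R.
Proof. exact/ln_gt0/golden_gt1. Qed.

Lemma TN_X (R : realType) (x : R) : X (TN x).
Proof.
rewrite /X /TN /= in_itv /=; case: ifPn => _; first by apply/andP; split; lra.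
set y := Num.sg x / x.
have := floor_itv (y + 1 / 2).
by rewrite intrD => /andP[? ?]; apply/andP; split; lra.
Qed.

Lemma rho_ge0 (R : realType) (x : R) : 0 <= rho x.
Proof.
have g1 := @golden_gt1 R; have l0 := @ln_golden_gt0 R.
rewrite /rho; case: ifPn => [/andP[? ?]|_].
  by rewrite mulr_ge0// divr_ge0//; lra.
case: ifPn => [/andP[? ?]|//].
by rewrite mulr_ge0// divr_ge0//; lra.
Qed.

Lemma continuous_golden_inv (R : realType) (c x : R) : 0 < c + x ->
  {for x, continuous (fun y : R => 1 / ln golden * (1 / (c + y)))}.
Proof.
move=> cx0; apply: cvgM; first exact: cvg_cst.
apply: cvgM; first exact: cvg_cst.
apply: cvgV; first by rewrite gt_eqF.
by apply: cvgD; [exact: cvg_cst|exact: cvg_id].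
Qed.

Lemma measurable_golden_inv (R : realType) (c : R) (D : set R) :
  measurable D -> (forall x, D x -> 0 < c + x) ->
  measurable_fun D (fun x : R => 1 / ln golden * (1 / (c + x))).
Proof.
move=> mD D0; apply: subspace_continuous_measurable_fun => //.
by apply: continuous_in_subspaceT => x /[!inE] /D0; exact: continuous_golden_inv.
Qed.

Lemma measurable_rho (R : realType) : measurable_fun setT (@rho R).
Proof.
have g1 := @golden_gt1 R.
have m1 (p q : R) : measurable_fun setT (fun x : R => p <= x < q).
  by apply: measurable_and; [exact: measurable_fun_ler|exact: measurable_fun_ltr].
have s1 (p q : R) :
    setT `&` (fun x : R => p <= x < q) @^-1` [set true] = `[p, q[%classic.
  by apply/seteqP; split=> [x [_]|x] /=; rewrite in_itv.
rewrite /rho; apply: measurable_fun_if => //=.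
  rewrite s1; apply: measurable_golden_inv => // x /=.
  by rewrite in_itv/= => /andP[? ?]; lra.
apply: measurable_funTS; apply: measurable_fun_if => //=.
rewrite s1; apply: measurable_golden_inv => // x /=.
by rewrite in_itv/= => /andP[? ?]; lra.
Qed.

Lemma muN0 (R : realType) : muN set0 = 0%E :> \bar R.
Proof. by rewrite /muN integral_set0. Qed.

Lemma muN_ge0 (R : realType) (A : set R) : (0 <= muN A)%E.
Proof. by apply: integral_ge0 => x _; rewrite lee_fin rho_ge0. Qed.

Lemma muN_semi_sigma_additive (R : realType) :
  semi_sigma_additive (@muN R).
Proof.
move=> /= F mF tF mUF; rewrite /muN; apply: cvg_toP.
  apply: ereal_nondecreasing_is_cvgn => m n mn.
  apply: lee_sum_nneg_natr => // k _ _.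
  by apply: integral_ge0 => /= x _; rewrite lee_fin rho_ge0.
rewrite ge0_integral_bigcup//=.
- apply: measurable_funTS; apply: measurableT_comp => //.
  exact: measurable_rho.
- by move=> x _; rewrite lee_fin rho_ge0.
Qed.

HB.instance Definition _ (R : realType) :=
  isMeasure.Build _ _ _ (@muN R)
    (@muN0 R) (@muN_ge0 R) (@muN_semi_sigma_additive R).

Lemma integral_golden_inv (R : realType) (c p q : R) : p < q -> 0 < c + p ->
  (\int[lebesgue_measure]_(x in `[p, q[) (1 / ln golden * (1 / (c + x)))%:E =
   ((ln (c + q) - ln (c + p)) / ln golden)%:E)%E.
Proof.
move=> pq cp0.
have l0 := @ln_golden_gt0 R.
rewrite integral_itv_bndo_bndc; last first.
  apply/measurable_EFinP; apply: measurable_golden_inv => // x /=.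
  by rewrite in_itv/= => /andP[? ?]; lra.
pose F (x : R) := 1 / ln golden * ln (c + x).
have dF (x : R) : 0 < c + x -> is_derive x 1 F (1 / ln golden * (1 / (c + x))).
  move=> cx0.
  have dl : is_derive x 1 (@ln R \o (fun y : R => c + y)) ((c + x)^-1).
    have d1 := is_derive1_ln cx0.
    have d2 : is_derive x 1 (fun y : R => c + y) 1.
      by apply: (@is_derive_eq _ _ _ (cst c + id)); rewrite add0r.
    rewrite -[(c + x)^-1]mulr1.
    exact: (@is_derive1_comp _ (@ln R) (fun y : R => c + y)).
  rewrite [1 / (c + x)]div1r; exact: (is_deriveZ (1 / ln golden) dl).
have cF (x : R) : 0 < c + x -> {for x, continuous F}.
  move=> /dF [+ _] => /derivable1_diffP; exact: differentiable_continuous.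
rewrite (@continuous_FTC2 _ _ F) //.
- by rewrite -EFinB /F; congr (_%:E); field; rewrite gt_eqF.
- apply: continuous_in_subspaceT => x /[!inE]/=.
  rewrite in_itv/= => /andP[? ?]; apply: continuous_golden_inv; lra.
- split.
  + by move=> x; rewrite in_itv/= => /andP[? ?]; case: (dF x) => //; lra.
  + by apply: cvg_at_right_filter; apply: cF.
  + by apply: cvg_at_left_filter; apply: cF; lra.
- move=> x; rewrite in_itv/= => /andP[? ?]; rewrite derive1E.
  by case: (dF x) => //; lra.
Qed.

Lemma muN_X (R : realType) : muN X = 1%E :> \bar R.
Proof.
have g1 := @golden_gt1 R; have l0 := @ln_golden_gt0 R.
rewrite /muN.
have -> : @X R = `[- (1 / 2), 0[%classic `|` `[0, 1 / 2[%classic.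
  apply/seteqP; split=> x; rewrite /X /= !in_itv /=.
    move=> /andP[x1 x2]; have [x0|x0] := ltP x 0; [left|right].
      by rewrite x1.
    by rewrite x2.
  by move=> [/andP[? ?]|/andP[? ?]]; apply/andP; split; lra.
rewrite ge0_integral_setU //=; last 3 first.
- by apply: measurable_funTS; apply/measurable_EFinP; exact: measurable_rho.
- by move=> x _; rewrite lee_fin rho_ge0.
- apply/disj_setPS => x /=; rewrite !in_itv/= => -[/andP[? ?] /andP[? ?]]; lra.
have pq1 : - (1 / 2) < 0 :> R by lra.
have pq2 : 0 < 1 / 2 :> R by lra.
have gp1 : 0 < golden + 1 - 1 / 2 :> R by lra.
have gp2 : 0 < golden + 0 :> R by lra.
have -> : (\int[lebesgue_measure]_(x in `[(- (1 / 2))%R, 0%R[) (rho x)%:E =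
    ((ln (golden + 1 + 0) - ln (golden + 1 - 1 / 2)) / @ln R golden)%:E)%E.
  rewrite -(integral_golden_inv pq1 gp1).
  apply: eq_integral => x /[!inE]/=; rewrite in_itv/= /rho => /andP[x1 x2].
  by rewrite leNgt x2 /= x1.
have -> : (\int[lebesgue_measure]_(x in `[0%R, (1 / 2)%R[) (rho x)%:E =
    ((ln (golden + 1 / 2) - ln (golden + 0)) / @ln R golden)%:E)%E.
  rewrite -(integral_golden_inv pq2 gp2).
  by apply: eq_integral => x /[!inE]/=; rewrite in_itv/= /rho => ->.
have -> : golden + 1 - 1 / 2 = golden + 1 / 2 :> R by lra.
rewrite !addr0 -golden_sqr lnXn ?(lt_trans _ g1)// -EFinD; congr (_%:E).
by rewrite mulr2n; field; rewrite gt_eqF.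
Qed.

Lemma muN_setT (R : realType) : muN setT = 1%E :> \bar R.
Proof.
rewrite -muN_X /muN -[X]setTI [RHS]integral_mkcondr.
apply: eq_integral => x _; rewrite patchE; case: ifPn => //.
rewrite notin_setE /X /= in_itv/= => /negP xX.
rewrite /rho; case: ifPn => [/andP[? ?]|_].
  by exfalso; apply: (negP xX); apply/andP; split; lra.
case: ifPn => [/andP[? ?]|//].
by exfalso; apply: (negP xX); apply/andP; split; lra.
Qed.

HB.instance Definition _ (R : realType) :=
  Measure_isProbability.Build _ _ R (@muN R) (@muN_setT R).

(* Main.v *)
(* Both the digit [b1 x] and [TN x] depend on [`|x|] only, so everything happens for
   the folded map [fold x = `|1/x - nearest integer|] of [[0, 1/2]], whose branches
   are all full, with the folded density [rho_fold].

   - The transfer operator of [fold] halves the Lipschitz constant of a function of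
     mean zero, since its supremum is at most half of that constant.  Hence
     [fold^-k B] decorrelates exponentially from Lipschitz densities, uniformly in
     the Borel set [B].
   - Because 1/G + 1/G^2 = 1, the transfer operator telescopes on [rho_fold]: this
     gives its invariance, and the density after one step, started from [rho_fold]
     restricted to [b1 > u], in closed form.  Its deviation from [a * rho_fold],
     [a] being the mass of [b1 > u], has mean zero and a Lipschitz constant [O(a)].
   - So conditioning on the first digit gives for [p_N(j) = P(S_N = j)] the
     recursion [p_(N+1)(j) = (1 - a) p_N(j) + a p_N(j-1)] up to [o(a)], which is the
     recursion of the binomial law with parameter [a].  As [n a] tends to [1/r],
     Poisson's limit theorem concludes. *)

Require Import Defs.
From HB Require Import structures.
From mathcomp Require Import all_boot all_order all_algebra.
From mathcomp Require Import all_classical all_reals all_analysis.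
From mathcomp Require Import measurable_realfun.
From mathcomp Require Import ring lra zify.
Import Order.TTheory GRing.Theory Num.Theory.
Import numFieldNormedType.Exports.
Local Open Scope classical_set_scope.
Local Open Scope ring_scope.

Set Implicit Arguments.
Unset Strict Implicit.
Unset Printing Implicit Defensive.

(** * Transfer of densities *)

Section transfer.
Context {R : realType}.
Local Notation mu := (@lebesgue_measure R).
Implicit Types (x y t L : R) (A B D E : set R) (f g h : R -> R).

Lemma integrable_subset E D f : measurable E -> measurable D -> D `<=` E ->
  mu.-integrable E (EFin \o f) -> mu.-integrable D (EFin \o f).
Proof. by move=> mE mD DE; exact: (@integrableS _ _ _ mu E). Qed.

(* The class of rays generates the Borel sets, and both sides of the conclusion
   are sigma-additive in [B]. *)
Lemma Rintegral_preimage_unique D E f g (psi : R -> R) :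
  measurable D -> measurable E ->
  mu.-integrable D (EFin \o f) -> mu.-integrable E (EFin \o g) ->
  measurable_fun setT psi ->
  \int[mu]_(x in D) f x = \int[mu]_(x in E) g x ->
  (forall z, \int[mu]_(x in D `&` psi @^-1` `]z, +oo[) f x =
             \int[mu]_(x in E `&` `]z, +oo[) g x) ->
  forall B, measurable B ->
  \int[mu]_(x in D `&` psi @^-1` B) f x = \int[mu]_(x in E `&` B) g x.
Proof.
move=> mD mE intf intg mpsi tot ray B mB.
have mp A : measurable A -> measurable (psi @^-1` A).
  by move=> mA; rewrite -[X in measurable X]setTI; exact: mpsi.
pose P : set_system R := [set B |
  \int[mu]_(x in D `&` psi @^-1` B) f x = \int[mu]_(x in E `&` B) g x].
apply: (@dynkin_induction _ R (@RGenOInfty.G R) P).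
- exact: RGenOInfty.measurableE.
- move=> _ _ [x ->] [y ->]; exists (Num.max x y).
  by apply/seteqP; split=> z /=; rewrite !in_itv/= !andbT gt_max => /andP.
- by rewrite /P/= preimage_setT !setIT.
- by move=> _ [x ->]; exact: ray.
- move=> S mS; rewrite /P/= => PS.
  have split (E' S' : set R) k : measurable E' -> measurable S' ->
      mu.-integrable E' (EFin \o k) ->
      \int[mu]_(x in E') k x =
      \int[mu]_(x in E' `&` S') k x + \int[mu]_(x in E' `&` ~` S') k x.
    move=> mE' mS' ik; have eq : E' = (E' `&` S') `|` (E' `&` ~` S').
      by rewrite -setIUr setUv setIT.
    rewrite {1}eq Rintegral_setU -?eq//; first exact: measurableI.
      by apply: measurableI => //; exact: measurableC.
    by rewrite disj_set2E; apply/eqP; rewrite setIACA setICr setI0.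
  move: tot; rewrite (split _ _ _ mD (mp _ mS) intf) (split _ _ _ mE mS intg).
  by rewrite PS preimage_setC; exact: addrI.
- move=> F mF tF PF; rewrite /P/= preimage_bigcup !setI_bigcupr /Rintegral.
  have mEF k : measurable (E `&` F k) by exact: measurableI.
  have mDF k : measurable (D `&` psi @^-1` F k).
    by apply: measurableI => //; exact: mp.
  have iE k : mu.-integrable (E `&` F k) (EFin \o g).
    exact: integrable_subset intg.
  have iD k : mu.-integrable (D `&` psi @^-1` F k) (EFin \o f).
    exact: integrable_subset intf.
  have iEU : mu.-integrable (\bigcup_k (E `&` F k)) (EFin \o g).
    apply: integrable_subset intg => //; first exact: bigcup_measurable.
    by move=> x [k _ []].
  have iDU : mu.-integrable (\bigcup_k (D `&` psi @^-1` F k)) (EFin \o f).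
    apply: integrable_subset intf => //; first exact: bigcup_measurable.
    by move=> x [k _ []].
  rewrite !integral_bigcup//.
  + congr fine; apply: eq_eseriesr => i _.
    have := congr1 EFin (PF i); rewrite /Rintegral !fineK//.
    * by apply: integrable_fin_num; [exact: mEF|exact: iE].
    * by apply: integrable_fin_num; [exact: mDF|exact: iD].
  + exact/trivIset_setIl.
  + by move=> a b _ _ [x [[_ Fa] [_ Fb]]]; apply: tF => //; exists (psi x).
- by move: mB; rewrite [X in X B]RGenOInfty.measurableE.
Qed.

Definition halfI : set R := `[0, 1 / 2]%classic.

Definition lipI L h :=
  forall x y, halfI x -> halfI y -> `|h x - h y| <= L * `|x - y|.

Lemma measurable_halfI : measurable halfI.
Proof. exact: measurable_itv. Qed.

Lemma halfIP x : halfI x <-> 0 <= x <= 1 / 2.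
Proof. by rewrite /halfI/= in_itv. Qed.

Lemma lipI_continuous L h : lipI L h -> {within halfI, continuous h}.
Proof.
move=> lh; apply/subspace_continuousP => x Ix.
apply/cvgrPdist_lt => e e0; rewrite near_withinE.
have L1 : 0 < `|L| + 1 by rewrite ltr_wpDl.
have : \forall y \near x, `|x - y| < e / (`|L| + 1).
  by apply: (@nbhsx_ballx _ _ x); rewrite divr_gt0.
apply: filterS => y; rewrite ltr_pdivlMr// => xy Iy.
apply: le_lt_trans (lh _ _ Ix Iy) _; apply: le_lt_trans xy.
rewrite mulrC ler_wpM2l//; have := ler_norm L; lra.
Qed.

Lemma lipI_ge0 L h : lipI L h -> 0 <= L.
Proof.
move=> lh; have := lh 0 (1 / 2).
have -> : `|0 - 1 / 2 : R| = 1 / 2 by rewrite ler0_norm; lra.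
move=> /(_ _ _)/(le_trans (normr_ge0 _)) H.
have : 0 <= L * (1 / 2) by apply: H; apply/halfIP; lra.
lra.
Qed.

Lemma lipI_bound L h : lipI L h -> forall x, halfI x -> `|h x| <= `|h 0| + L.
Proof.
move=> lh x Ix; have I0 : halfI 0 by apply/halfIP; lra.
have := lh _ _ Ix I0; have := lipI_ge0 lh; have := ler_normD (h x - h 0) (h 0).
move: Ix => /halfIP Ix; rewrite subrK subr0 [`|x|]ger0_norm; last lra.
move=> ? ? ?; have : L * x <= L * 1 by rewrite ler_wpM2l//; lra.
lra.
Qed.

Lemma integrable_within D f : measurable D -> D `<=` halfI ->
  measurable_fun D f -> [bounded f x | x in D] -> mu.-integrable D (EFin \o f).
Proof.
move=> mD DI mf bf; apply: measurable_bounded_integrable => //.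
apply: (@le_lt_trans _ _ (mu halfI)).
  by apply: le_measure => //; rewrite inE; [exact: mD|exact: measurable_halfI].
by rewrite lebesgue_measure_itv/= lte_fin; case: ifPn => _; rewrite ?ltry.
Qed.

Lemma lipI_integrable L h D : lipI L h -> measurable D -> D `<=` halfI ->
  mu.-integrable D (EFin \o h).
Proof.
move=> lh mD DI.
apply: integrable_within => //.
  apply: (@measurable_funS _ _ _ _ halfI) => //.
    exact: measurable_halfI.
  apply: subspace_continuous_measurable_fun; first exact: measurable_halfI.
  exact: lipI_continuous lh.
exists (`|h 0| + L); split; first exact: num_real.
by move=> M LM x /DI/(lipI_bound lh)/le_trans; apply; exact: ltW.
Qed.

End transfer.

(** * The folded map and its inverse branches *)

Section branches.
Context {R : realType}.
Local Notation mu := (@lebesgue_measure R).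
Implicit Types (x y c d s T : R) (h : R -> R).

Section inverse_substitution.
Context (T s : R).
(** An inverse branch of the folded map. The sign [s] is fixed to 1 or -1 only in the two
    substitution lemmas, so that both orientations share the facts on derivatives and limits. *)
Let F y := (T + s * y)^-1.

Let is_derive_F y : 0 < T + s * y -> is_derive y 1 F (- s * (T + s * y) ^- 2).
Proof.
move=> Ty0.
have d1 : is_derive y 1 (fun y => T + s * y) s.
  have -> : (fun y : R => T + s * y) = (cst T + s \*: id).
    by apply/funext => z; rewrite !fctE.
  by apply: is_derive_eq; rewrite add0r /GRing.scale/= mulr1.
have Ty : T + s * y != 0 by rewrite gt_eqF.
have H := @is_deriveV _ (fun y => T + s * y) y s 1 Ty d1.
have -> : - s * (T + s * y) ^- 2 = - (T + s * y) ^- 2 *: s.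
  by rewrite /GRing.scale/= mulrC mulrN mulNr.
exact: H.
Qed.

Let near_pos y : 0 < T + s * y -> \forall z \near y, 0 < T + s * z.
Proof.
move=> Ty0; have H : (T + s * z) @[z --> y] --> T + s * y.
  apply: cvgD; first exact: cvg_cst.
  by apply: cvgM; [exact: cvg_cst|exact: cvg_id].
exact: cvgr_gt H _ Ty0.
Qed.

Let cvg_dF y : 0 < T + s * y -> derive1 F z @[z --> y] --> - s * (T + s * y) ^- 2.
Proof.
move=> Ty0.
have : - s * (T + s * z) ^- 2 @[z --> y] --> - s * (T + s * y) ^- 2.
  apply: cvgM; first exact: cvg_cst.
  apply: cvgV; first by rewrite sqrf_eq0 gt_eqF.
  rewrite expr2; under eq_fun do rewrite expr2.
  by apply: cvgM; (apply: cvgD; first exact: cvg_cst);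
    apply: cvgM; [exact: cvg_cst|exact: cvg_id|exact: cvg_cst|exact: cvg_id].
apply: cvg_trans; apply: near_eq_cvg.
apply: filterS (near_pos Ty0) => z Tz0.
by rewrite derive1E; have [_ ->] := is_derive_F Tz0.
Qed.

Let cvg_F y : 0 < T + s * y -> F z @[z --> y] --> F y.
Proof.
move=> /is_derive_F[+ _] => /derivable1_diffP.
exact: differentiable_continuous.
Qed.

Let pos_between c d y : 0 < T + s * c -> 0 < T + s * d -> c <= y <= d ->
  0 < T + s * y.
Proof.
move=> Tc Td /andP[cy yd]; have [s0|s0] := leP 0 s.
  by have : s * c <= s * y by [rewrite ler_wpM2l]; lra.
by have : s * d <= s * y by [rewrite ler_nM2l]; lra.
Qed.

Lemma integral_inv_decreasing c d h : c <= d -> s = 1 -> 0 < T + s * c ->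
  {within `[F d, F c], continuous h} ->
  \int[mu]_(x in `[F d, F c]) h x =
  \int[mu]_(y in `[c, d]) (h (F y) * (T + s * y) ^- 2).
Proof.
move=> cd s1 Tc ch; have Td : 0 < T + s * d by move: Tc; rewrite s1; lra.
rewrite /Rintegral (@integration_by_substitution_decreasing _ F)//.
- congr fine; apply: eq_integral => y; rewrite inE/= in_itv/= => yd.
  congr EFin; rewrite !fctE/= derive1E.
  by have [_ ->] := is_derive_F (pos_between Tc Td yd); rewrite s1 mulN1r opprK.
- move=> x y; rewrite !in_itv/= => xd yd xy; rewrite /F ltf_pV2 ?posrE.
  + by rewrite s1; lra.
  + exact: pos_between xd.
  + exact: pos_between yd.
- move=> y; rewrite in_itv/= => yd.
  have Ty : 0 < T + s * y by apply: (pos_between Tc Td); lra.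
  have := cvg_dF Ty; have [_ <-] := is_derive_F Ty.
  by rewrite -derive1E.
- apply/cvg_ex; exists (- s * (T + s * c) ^- 2).
  by apply: cvg_at_right_filter; exact: cvg_dF.
- apply/cvg_ex; exists (- s * (T + s * d) ^- 2).
  by apply: cvg_at_left_filter; exact: cvg_dF.
- split.
  + move=> y; rewrite in_itv/= => yd.
    have Ty : 0 < T + s * y by apply: (pos_between Tc Td); lra.
    by have [] := is_derive_F Ty.
  + by apply: cvg_at_right_filter; exact: cvg_F.
  + by apply: cvg_at_left_filter; exact: cvg_F.
Qed.

Lemma integral_inv_increasing c d h : c <= d -> s = -1 -> 0 < T + s * d ->
  {within `[F c, F d], continuous h} ->
  \int[mu]_(x in `[F c, F d]) h x =
  \int[mu]_(y in `[c, d]) (h (F y) * (T + s * y) ^- 2).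
Proof.
move=> cd s1 Td ch; have Tc : 0 < T + s * c by move: Td; rewrite s1; lra.
rewrite /Rintegral (@integration_by_substitution_increasing _ F)//.
- congr fine; apply: eq_integral => y; rewrite inE/= in_itv/= => yd.
  congr EFin; rewrite !fctE/= derive1E.
  by have [_ ->] := is_derive_F (pos_between Tc Td yd); rewrite s1 opprK mul1r.
- move=> x y; rewrite !in_itv/= => xd yd xy; rewrite /F ltf_pV2 ?posrE.
  + by rewrite s1; lra.
  + exact: pos_between xd.
  + exact: pos_between yd.
- move=> y; rewrite in_itv/= => yd.
  have Ty : 0 < T + s * y by apply: (pos_between Tc Td); lra.
  have := cvg_dF Ty; have [_ <-] := is_derive_F Ty.
  by rewrite -derive1E.
- apply/cvg_ex; exists (- s * (T + s * c) ^- 2).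
  by apply: cvg_at_right_filter; exact: cvg_dF.
- apply/cvg_ex; exists (- s * (T + s * d) ^- 2).
  by apply: cvg_at_left_filter; exact: cvg_dF.
- split.
  + move=> y; rewrite in_itv/= => yd.
    have Ty : 0 < T + s * y by apply: (pos_between Tc Td); lra.
    by have [] := is_derive_F Ty.
  + by apply: cvg_at_right_filter; exact: cvg_F.
  + by apply: cvg_at_left_filter; exact: cvg_F.
Qed.

End inverse_substitution.

Definition digit x : int := Num.floor (x^-1 + 1 / 2).

(** At 0 the convention [0^-1 = 0] gives [fold 0 = 0], in agreement with [TN 0 = 0]. *)
Definition fold x : R := `|x^-1 - (digit x)%:~R|.

(* The inverse branches of [fold] are indexed by the half-integers [tb n]: on
   [piece n], where [x^-1] lies in [[tb n, tb n.+1[], the nearest integer to [x^-1]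
   is the integer one of the two endpoints, so that [x^-1 = br n (fold x)]. *)
Definition tb n : R := (n%:R + 4) / 2.

Definition br n y : R := (if odd n then tb n.+1 else tb n) + (-1) ^+ n * y.

Definition piece n : set R := `](tb n.+1)^-1, (tb n)^-1]%classic.

(** The term of branch [n] in the transfer operator of [fold]: [br n y ^- 2] is the absolute
    derivative of the inverse branch that sends [y] to [(br n y)^-1]. *)
Definition tr n h y : R := h (br n y)^-1 * br n y ^- 2.

Lemma tbS n : tb n.+1 = tb n + 1 / 2.
Proof. by rewrite /tb -natr1; field. Qed.

Lemma tb_ge2 n : 2 <= tb n.
Proof. by rewrite /tb; have : 0 <= n%:R :> R by []; lra. Qed.

Lemma br_itv n y : halfI y -> tb n <= br n y <= tb n.+1.
Proof.
move/halfIP => Iy; rewrite /br -signr_odd; have := tbS n.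
by case: (odd n); rewrite ?expr1 ?expr0 => ->; lra.
Qed.

Lemma br_ge2 n y : halfI y -> 2 <= br n y.
Proof. by move=> /(br_itv n) => H; have := tb_ge2 n; lra. Qed.

Lemma inv_halfI (t : R) : 2 <= t -> halfI t^-1.
Proof.
move=> t2; apply/halfIP; have t0 : 0 < t by lra.
by rewrite invr_ge0 ltW//= div1r lef_pV2 ?posrE//; lra.
Qed.

Lemma br_inv_halfI n y : halfI y -> halfI (br n y)^-1.
Proof. by move=> Iy; exact/inv_halfI/br_ge2. Qed.

Lemma pieceP n x : piece n x -> 0 < x /\ tb n <= x^-1 < tb n.+1.
Proof.
have t2 := tb_ge2 n; have t2' := tb_ge2 n.+1.
rewrite /piece/= in_itv/= => /andP[lx xu].
have x0 : 0 < x by apply: lt_trans lx; rewrite invr_gt0; lra.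
split=> //; apply/andP; split.
  by rewrite -[tb n]invrK lef_pV2 ?posrE// invr_gt0; lra.
by rewrite -[tb n.+1]invrK ltf_pV2 ?posrE// invr_gt0; lra.
Qed.

Lemma piece_halfI n : piece n `<=` halfI.
Proof.
move=> x /pieceP[x0 /andP[tx _]]; rewrite -[x]invrK; apply: inv_halfI.
by have := tb_ge2 n; lra.
Qed.

Lemma digit_piece n x : piece n x -> (digit x)%:~R = if odd n then tb n.+1 else tb n.
Proof.
move=> /pieceP[x0 tx]; rewrite /digit.
have nE : n%:R = (odd n)%:R + 2 * n./2%:R :> R.
  by rewrite -[in LHS](odd_double_half n) natrD -mul2n natrM.
have -> : Num.floor (x^-1 + 1 / 2) = (n./2 + 2 + odd n)%:Z.
  apply: floor_def; rewrite intrD -!pmulrn !natrD.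
  move: tx; rewrite /tb -[n.+1%:R]natr1 nE.
  by case: (odd n) => /=; lra.
rewrite -pmulrn !natrD /tb -[n.+1%:R]natr1 nE.
by case: (odd n) => /=; lra.
Qed.

Lemma fold_piece n x : piece n x ->
  fold x = if odd n then tb n.+1 - x^-1 else x^-1 - tb n.
Proof.
move=> px; rewrite /fold (digit_piece px).
have [_] := pieceP px; case: (odd n) => tx; last by rewrite ger0_norm; lra.
by rewrite ltr0_norm; lra.
Qed.

End branches.

(** * The transfer operator of the folded map *)

Section transfer_operator.
Context {R : realType}.
Local Notation mu := (@lebesgue_measure R).
Implicit Types (x y c d s T L : R) (h H : R -> R) (B D : set R).

Lemma measurable_invr : measurable_fun setT (fun x : R => x^-1).
Proof.
have m0 : measurable [set (0 : R)] by [].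
have mC : measurable (~` [set (0 : R)]) by exact: measurableC.
rewrite -(setUv [set 0]); apply/measurable_funU => //.
split; first exact: measurable_fun_set1.
apply: subspace_continuous_measurable_fun => //.
apply: continuous_in_subspaceT => x /[!inE] /eqP x0.
exact: inv_continuous.
Qed.

Lemma measurable_digit : measurable_fun setT (fun x : R => (digit x)%:~R : R).
Proof.
apply: (measurableT_comp (f := fun x : R => (Num.floor x)%:~R : R)).
  apply: nondecreasing_measurable => // x y xy.
  by rewrite ler_int le_floor.
apply: measurable_funD; first exact: measurable_invr.
exact: measurable_cst.
Qed.

Lemma measurable_fold : measurable_fun setT (@fold R).
Proof.
apply: measurableT_comp; first exact: normr_measurable.
apply: measurable_funB; first exact: measurable_invr.
exact: measurable_digit.
Qed.

Lemma measurable_preimage_fold B : measurable B -> measurable (@fold R @^-1` B).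
Proof. by move=> mB; rewrite -[X in measurable X]setTI; exact: measurable_fold. Qed.

Lemma measurable_piece n : measurable (piece n : set R).
Proof. exact: measurable_itv. Qed.

Lemma Rintegral_itv_endpoints (a b : R) f : mu.-integrable `[a, b] (EFin \o f) ->
  [/\ \int[mu]_(x in `[a, b[) f x = \int[mu]_(x in `[a, b]) f x,
      \int[mu]_(x in `]a, b]) f x = \int[mu]_(x in `[a, b]) f x &
      \int[mu]_(x in `]a, b[) f x = \int[mu]_(x in `[a, b]) f x].
Proof.
move=> intf.
have sub (b1 b2 : bool) :
    mu.-integrable [set` Interval (BSide b1 a) (BSide b2 b)] (EFin \o f).
  apply: integrable_subset intf; [exact: measurable_itv|exact: measurable_itv|].
  by apply: subset_itv; rewrite bnd_simp//; case: b1 b2 => -[].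
have e1 := Rintegral_itv_bndo_bndc (sub true true).
have e2 := Rintegral_itv_obnd_cbnd (sub false false).
by split=> //; rewrite Rintegral_itv_bndo_bndc//; exact: (sub false true).
Qed.

(** Put [p = br n x], [q = br n y] and [t = tb n]; then [p] and [q] are at least [t] and at distance
    [|x - y|]. The difference splits into [h(1/p) (p^-2 - q^-2)], which contributes [2 M t^-3], and
    [(h(1/p) - h(1/q)) q^-2], which contributes [L t^-2] times [t^-2]. *)
Lemma lipI_tr n L M h : lipI L h -> (forall x, halfI x -> `|h x| <= M) ->
  lipI (2 * M / tb n ^+ 3 + L / tb n ^+ 4) (tr n h).
Proof.
move=> lh hM x y Ix Iy; rewrite /tr.
have /andP[tx _] := br_itv n Ix; have /andP[ty _] := br_itv n Iy.
have t2 := @tb_ge2 R n; have L0 := lipI_ge0 lh.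
have M0 : 0 <= M by apply: le_trans (hM _ Ix); exact: normr_ge0.
have bxy : `|br n x - br n y| = `|x - y|.
  have -> : br n x - br n y = (-1) ^+ n * (x - y) by rewrite /br; ring.
  by rewrite normrM normrX normrN1 expr1n mul1r.
have := lh _ _ (br_inv_halfI n Ix) (br_inv_halfI n Iy).
have := hM _ (br_inv_halfI n Ix).
move: (br n x) (br n y) tx ty bxy => p q tp tq <-.
set t := tb n in tp tq t2 *.
have t0 : 0 < t by lra.
have p0 : 0 < p by lra.
have q0 : 0 < q by lra.
set hp := h p^-1; set hq := h q^-1 => hpM hpq.
have -> : hp * p ^- 2 - hq * q ^- 2 =
    hp * (p ^- 2 - q ^- 2) + (hp - hq) * q ^- 2 by ring.
have ip : p^-1 <= t^-1 by rewrite lef_pV2 ?posrE.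
have iq : q^-1 <= t^-1 by rewrite lef_pV2 ?posrE.
have ip0 : 0 < p^-1 by rewrite invr_gt0.
have iq0 : 0 < q^-1 by rewrite invr_gt0.
have it0 : 0 < t^-1 by rewrite invr_gt0.
have d0 : 0 <= `|p - q| by [].
apply: le_trans (ler_normD _ _) _; rewrite [leRHS]mulrDl; apply: lerD.
- have -> : p ^- 2 - q ^- 2 = (q - p) * (p^-1 * q^-1 * (p^-1 + q^-1)).
    by field; rewrite !gt_eqF.
  rewrite !normrM [`|q - p|]distrC.
  rewrite [`|p^-1 + _|]gtr0_norm ?addr_gt0// [`|p^-1|]gtr0_norm// [`|q^-1|]gtr0_norm//.
  have -> : 2 * M / t ^+ 3 * `|p - q| = M * (`|p - q| * (t^-1 * t^-1 * (t^-1 + t^-1))).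
    by field; rewrite gt_eqF.
  apply: ler_pM => //; first by rewrite !mulr_ge0 ?addr_ge0// ltW.
  apply: ler_wpM2l => //; apply: ler_pM;
    rewrite ?mulr_ge0 ?addr_ge0 ?(ltW ip0) ?(ltW iq0)//.
    by apply: ler_pM; rewrite ?(ltW ip0) ?(ltW iq0).
  by rewrite lerD.
- rewrite normrM.
  have : `|p^-1 - q^-1| <= `|p - q| * (t^-1 * t^-1).
    have -> : p^-1 - q^-1 = (q - p) * (p^-1 * q^-1) by field; rewrite !gt_eqF.
    rewrite !normrM distrC [`|p^-1|]gtr0_norm// [`|q^-1|]gtr0_norm//.
    by rewrite ler_wpM2l// ler_pM// ltW.
  move=> pq.
  have -> : L / t ^+ 4 * `|p - q| = L * (`|p - q| * (t^-1 * t^-1)) * (t^-1 * t^-1).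
    by field; rewrite gt_eqF.
  apply: ler_pM => //.
    by apply: le_trans hpq _; rewrite ler_wpM2l.
  rewrite -exprVn expr2 gtr0_norm ?mulr_gt0//.
  by apply: ler_pM; rewrite ?(ltW iq0).
Qed.

Lemma tr_bound n M h y : (forall x, halfI x -> `|h x| <= M) -> halfI y ->
  `|tr n h y| <= M / tb n ^+ 2.
Proof.
move=> hM Iy; have /andP[ty _] := br_itv n Iy; have t2 := @tb_ge2 R n.
have t0 : 0 < tb n :> R by lra.
rewrite normrM; apply: ler_pM => //; first exact/hM/br_inv_halfI.
rewrite gtr0_norm ?invr_gt0 ?exprn_gt0 ?(lt_le_trans t0)//.
by rewrite lef_pV2 ?posrE ?exprn_gt0 ?(lt_le_trans t0)// lerXn2r ?nnegrE; lra.
Qed.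

Lemma lipI_bounded L h : lipI L h ->
  exists M, forall x, halfI x -> `|h x| <= M.
Proof. by move=> lh; exists (`|h 0| + L); exact: lipI_bound lh. Qed.

Lemma lipI_tr_ex n L h : lipI L h -> exists L', lipI L' (tr n h).
Proof.
move=> lh; have [M hM] := lipI_bounded lh.
by eexists; exact: lipI_tr lh hM.
Qed.

(** Up to an endpoint, the domain on the left is the part of [piece n] where [c <= fold x]: [fold]
    increases in [x] on odd pieces and decreases on even ones. The inverse branch is the change of
    variables. *)
Lemma Rintegral_piece_tail n L h c : lipI L h -> 0 <= c <= 1 / 2 ->
  \int[mu]_(x in if odd n then `[(tb n.+1 - c)^-1, (tb n)^-1]%classic
                  else `[(tb n.+1)^-1, (tb n + c)^-1]%classic) h x =
  \int[mu]_(y in `[c, (1 / 2)]) tr n h y.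
Proof.
move=> lh c01; have t2 := @tb_ge2 R n; have tS := @tbS R n.
rewrite /tr /br -[(-1) ^+ n]signr_odd.
have ch (a b : R) : 0 <= a -> b <= 1 / 2 -> {within `[a, b], continuous h}.
  move=> a0 b1; apply: continuous_subspaceW (lipI_continuous lh).
  by apply: subset_itv; rewrite bnd_simp.
case: (odd n).
- rewrite expr1 -(@integral_inv_increasing _ (tb n.+1) (-1) c (1 / 2) h) //.
  + by rewrite !mulN1r; have -> : tb n.+1 - 1 / 2 = tb n :> R by lra.
  + lra.
  + lra.
  + apply: ch; first by rewrite invr_ge0; lra.
    by rewrite div1r lef_pV2 ?posrE; lra.
- rewrite expr0 -(@integral_inv_decreasing _ (tb n) 1 c (1 / 2) h) //.
  + by rewrite [1 * c]mul1r [1 * (1 / 2)]mul1r -tS.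
  + lra.
  + lra.
  + apply: ch; first by rewrite invr_ge0; lra.
    by rewrite [leRHS]div1r lef_pV2 ?posrE; lra.
Qed.

(** By [Rintegral_preimage_unique] it suffices to test rays []z, +oo[]. If [z < 0] the ray contains
    all values of [fold], if [z >= 1/2] it contains none taken on the piece, and in between
    [Rintegral_piece_tail] applies with [c = z]. *)
Lemma piece_transfer n L h : lipI L h -> forall B, measurable B ->
  \int[mu]_(x in piece n `&` @fold R @^-1` B) h x =
  \int[mu]_(y in halfI `&` B) tr n h y.
Proof.
move=> lh; have [L' lt] := lipI_tr_ex n lh.
have t2 := @tb_ge2 R n; have tS := @tbS R n.
have it : mu.-integrable halfI (EFin \o tr n h).
  by apply: (lipI_integrable lt) => //; exact: measurable_halfI.
have ih (a b : R) : 0 <= a -> b <= 1 / 2 -> mu.-integrable `[a, b] (EFin \o h).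
  move=> a0 b1; apply: (lipI_integrable lh); first exact: measurable_itv.
  by apply: subset_itv; rewrite bnd_simp.
have tot : \int[mu]_(x in piece n) h x = \int[mu]_(y in halfI) tr n h y.
  have c0 : 0 <= (0 : R) <= 1 / 2 by lra.
  rewrite -(Rintegral_piece_tail n lh c0) subr0 addr0 if_same /piece.
  have [|_ -> _//] := @Rintegral_itv_endpoints (tb n.+1)^-1 (tb n)^-1 h.
  apply: ih; first by rewrite invr_ge0; lra.
  by rewrite div1r lef_pV2 ?posrE; lra.
apply: Rintegral_preimage_unique => //.
- exact: measurable_piece.
- exact: measurable_halfI.
- apply: (lipI_integrable lh); first exact: measurable_piece.
  exact: piece_halfI.
- exact: measurable_fold.
move=> z; have [z0|z0] := ltP z 0.
  have -> : piece n `&` @fold R @^-1` `]z, +oo[ = piece n.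
    apply/seteqP; split=> [x []//|x px]; split=> //=.
    by rewrite in_itv/= andbT (lt_le_trans z0)// normr_ge0.
  have -> // : halfI `&` `]z, +oo[ = halfI :> set R.
  apply/seteqP; split=> [x []//|x px]; split=> //=.
  by move/halfIP: px => ?; rewrite in_itv/= andbT; lra.
have [z1|z1] := leP (1 / 2) z.
  have -> : piece n `&` @fold R @^-1` `]z, +oo[ = set0.
    apply/seteqP; split=> // x [px] /=; rewrite in_itv/= andbT (fold_piece px).
    by have [_] := pieceP px; case: (odd n); lra.
  have -> // : halfI `&` `]z, +oo[ = set0 :> set R.
    by apply/seteqP; split=> // x [] /halfIP ?; rewrite /= in_itv/=; lra.
  by rewrite !Rintegral_set0.
have zI : 0 <= z <= 1 / 2 by lra.
have -> : halfI `&` `]z, +oo[ = `]z, (1 / 2)]%classic.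
  apply/seteqP; split=> x; rewrite /halfI/= !in_itv/= ?andbT.
    by move=> [] ?; lra.
  by move=> ?; split; lra.
have [|_ -> _] := @Rintegral_itv_endpoints z (1 / 2) (tr n h).
  apply: (lipI_integrable lt); first exact: measurable_itv.
  by apply: subset_itv; rewrite bnd_simp//; lra.
rewrite -(Rintegral_piece_tail n lh zI).
(* The set is rewritten as inequalities on [x^-1], which then turn into an interval for [x], one for
   each orientation of the branch. *)
have pE x : (piece n `&` @fold R @^-1` `]z, +oo[) x <->
    [/\ 0 < x, tb n <= x^-1 < tb n.+1 &
       if odd n then x^-1 < tb n.+1 - z else tb n + z < x^-1].
  split=> [[px]/=|[x0 xt xz]].
    rewrite in_itv/= andbT (fold_piece px); have [] := pieceP px.
    by case: (odd n) => ? ? ?; split=> //; lra.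
  have px : piece n x.
    rewrite /piece/= in_itv/= -[x]invrK ltf_pV2 ?lef_pV2 ?posrE ?invr_gt0//; lra.
  split=> //=; rewrite in_itv/= andbT (fold_piece px).
  by move: xz; case: (odd n) => ?; lra.
have inv0 x (t : R) : 0 < t -> t^-1 < x -> 0 < x.
  by move=> t0; apply: lt_trans; rewrite invr_gt0.
have invle x (t : R) : 0 < t -> 0 < x -> (t <= x^-1) = (x <= t^-1).
  by move=> t0 x0; rewrite -[t in LHS]invrK lef_pV2 ?posrE ?invr_gt0.
have invlt x (t : R) : 0 < t -> 0 < x -> (t < x^-1) = (x < t^-1).
  by move=> t0 x0; rewrite -[t in LHS]invrK ltf_pV2 ?posrE ?invr_gt0.
have invgt x (t : R) : 0 < t -> 0 < x -> (x^-1 < t) = (t^-1 < x).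
  by move=> t0 x0; rewrite -[t in LHS]invrK ltf_pV2 ?posrE ?invr_gt0.
have p0 : 0 < tb n :> R by lra.
have p1 : 0 < tb n.+1 :> R by lra.
have p2 : 0 < tb n.+1 - z :> R by lra.
have p3 : 0 < tb n + z :> R by lra.
case: ifPn pE => _ pE.
- have -> : piece n `&` @fold R @^-1` `]z, +oo[ =
      `](tb n.+1 - z)^-1, (tb n)^-1]%classic.
    apply/seteqP; split=> x.
      move=> /pE[x0 xt xz]; rewrite /= in_itv/= -invgt// xz -invle//.
      by have /andP[] := xt.
    rewrite /= in_itv/= => /andP[zx xt]; have x0 := inv0 _ _ p2 zx.
    apply/pE; split=> //; last by rewrite invgt.
    rewrite invle// xt/=; rewrite -invgt// in zx; lra.
  have [|_ -> _//] := @Rintegral_itv_endpoints (tb n.+1 - z)^-1 (tb n)^-1 h.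
  apply: ih; first by rewrite invr_ge0; lra.
  by rewrite div1r lef_pV2 ?posrE; lra.
- have -> : piece n `&` @fold R @^-1` `]z, +oo[ =
      `](tb n.+1)^-1, (tb n + z)^-1[%classic.
    apply/seteqP; split=> x.
      move=> /pE[x0 xt xz]; rewrite /= in_itv/= -invgt// -invlt// xz.
      by have /andP[_ ->] := xt.
    rewrite /= in_itv/= => /andP[zx xt]; have x0 := inv0 _ _ p1 zx.
    apply/pE; split=> //; last by rewrite invlt.
    rewrite invgt// zx andbT; rewrite -invlt// in xt; lra.
  have [|_ _ ->//] := @Rintegral_itv_endpoints (tb n.+1)^-1 (tb n + z)^-1 h.
  apply: ih; first by rewrite invr_ge0; lra.
  by rewrite [leRHS]div1r lef_pV2 ?posrE; lra.
Qed.

End transfer_operator.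

(** * Sums over the branches *)

Section contraction.
Context {R : realType}.
Local Notation mu := (@lebesgue_measure R).
Implicit Types (x y c d s T L M : R) (h H : R -> R) (A B D : set R).

Lemma piece_bigcup n : `]0, (tb n)^-1]%classic = \bigcup_i piece (n + i) :> set R.
Proof.
have t2 := @tb_ge2 R n.
apply/seteqP; split=> [x|x [i _]].
  rewrite /= in_itv/= => /andP[x0 xt].
  have tx : tb n <= x^-1 by rewrite -[tb n]invrK lef_pV2 ?posrE// invr_gt0; lra.
  (* Solving [tb (n + i) <= x^-1 < tb (n + i).+1] for [i] shows that the index is the integer part
     of [2 / x - 4 - n]. *)
  have /truncn_itv : 0 <= 2 * x^-1 - 4 - n%:R.
    by move: tx; rewrite /tb; lra.
  set k := Num.truncn _ => /andP[k1 k2]; exists k => //.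
  rewrite /piece/= in_itv/= /tb -addnS !natrD -[x]invrK.
  have ix0 : 0 < x^-1 by rewrite invr_gt0.
  have n0 : 0 <= n%:R :> R by [].
  have kk0 : 0 <= k%:R :> R by [].
  have kk1 : 0 <= k.+1%:R :> R by [].
  rewrite ltf_pV2 ?lef_pV2 ?posrE//; lra.
move=> /pieceP[x0 /andP[tx _]]; rewrite /= in_itv/= x0/= -[x]invrK.
rewrite lef_pV2 ?posrE ?invr_gt0//; last lra.
apply: le_trans tx; rewrite /tb natrD; have : 0 <= i%:R :> R by []; lra.
Qed.

Lemma trivIset_piece n : trivIset setT (fun i => piece (n + i) : set R).
Proof.
have H i j x : piece (n + i) x -> piece (n + j) x -> (i <= j)%N.
  move=> /pieceP[_ /andP[h1 _]] /pieceP[_ /andP[_ h2]].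
  have := le_lt_trans h1 h2; rewrite /tb -addnS !natrD => h3.
  by rewrite -ltnS -(ltr_nat R); lra.
move=> i j _ _ [x [xi xj]]; apply/eqP.
by rewrite eqn_leq (H _ _ _ xi xj) (H _ _ _ xj xi).
Qed.

(** With [k = n + i + 4] the term is [4 / k^2 <= 4 / (k - 1) - 4 / k], which telescopes from
    [4 / (n + 3)]. *)
Lemma sum_tb_inv2 n N : \sum_(0 <= i < N) (tb (n + i) ^- 2 : R) <= 4 / 3.
Proof.
have n0 : 0 <= n%:R :> R by [].
suff : \sum_(0 <= i < N) (tb (n + i) ^- 2 : R) <=
    4 / (n%:R + 3) - 4 / (n%:R + N%:R + 3).
  move/le_trans; apply.
  have : 0 <= 4 / (n%:R + N%:R + 3) :> R by rewrite divr_ge0.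
  have : 4 / (n%:R + 3) <= 4 / 3 :> R by rewrite ler_pM2l// lef_pV2 ?posrE; lra.
  lra.
elim: N => [|N IH]; first by rewrite big_geq// addr0 subrr.
rewrite big_nat_recr//=.
have N0 : 0 <= N%:R :> R by [].
have : (tb (n + N) ^- 2 : R) <= 4 / (n%:R + N%:R + 3) - 4 / (n%:R + N.+1%:R + 3).
  rewrite /tb natrD -[N.+1%:R]natr1.
  have -> : 4 / (n%:R + N%:R + 3) - 4 / (n%:R + (N%:R + 1) + 3) =
     4 / ((n%:R + N%:R + 3) * (n%:R + N%:R + 4)) :> R.
    by field; apply/andP; split; rewrite gt_eqF//; lra.
  have -> : ((n%:R + N%:R + 4) / 2) ^- 2 =
     4 / ((n%:R + N%:R + 4) * (n%:R + N%:R + 4)) :> R.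
    by field; rewrite gt_eqF//; lra.
  rewrite ler_pM2l// lef_pV2 ?posrE ?mulr_gt0 ?ler_pM2r//; lra.
lra.
Qed.

(** With [k = i + 4 >= 4] the term is [(8 + 16 / k) / k^3 <= 12 / ((k - 1) k (k + 1))], which
    telescopes as [6 / ((k - 1) k) - 6 / (k (k + 1))] from [6 / 12]. This value 1/2 becomes the
    contraction factor of the transfer operator. *)
Lemma sum_tb_inv34 N :
  \sum_(0 <= i < N) (tb i ^- 3 + tb i ^- 4 : R) <= 1 / 2.
Proof.
suff : \sum_(0 <= i < N) (tb i ^- 3 + tb i ^- 4 : R) <=
    1 / 2 - 6 / ((N%:R + 3) * (N%:R + 4)).
  move/le_trans; apply.
  by rewrite gerBl divr_ge0// mulr_ge0.
elim: N => [|N IH].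
  rewrite big_geq//; have -> : 6 / ((0%:R + 3) * (0%:R + 4)) = 1 / 2 :> R by field.
  by rewrite subrr.
rewrite big_nat_recr//=.
have N0 : 0 <= N%:R :> R by [].
have : (tb N ^- 3 + tb N ^- 4 : R) <=
    6 / ((N%:R + 3) * (N%:R + 4)) - 6 / ((N.+1%:R + 3) * (N.+1%:R + 4)).
  rewrite /tb -[N.+1%:R]natr1.
  set k : R := N%:R + 4.
  have k4 : 4 <= k by rewrite /k; lra.
  have -> : 6 / ((N%:R + 3) * k) - 6 / ((N%:R + 1 + 3) * (N%:R + 1 + 4)) =
     12 / ((k - 1) * k * (k + 1)) :> R.
    by rewrite /k; field; rewrite !gt_eqF//; lra.
  have -> : (k / 2) ^- 3 + (k / 2) ^- 4 = (8 + 16 / k) / (k * k * k) :> R.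
    by field; rewrite gt_eqF//; lra.
  apply: (@le_trans _ _ (12 / (k * k * k))).
    rewrite ler_pM2r; last by rewrite invr_gt0 !mulr_gt0//; lra.
    have : 16 / k <= 4 by rewrite ler_pdivrMr; lra.
    lra.
  by rewrite ler_pM2l// lef_pV2 ?posrE ?mulr_gt0//; nra.
lra.
Qed.

Lemma Rintegral_setI_fin D A h : measurable D -> measurable A ->
  mu.-integrable D (EFin \o h) ->
  (\int[mu]_(x in D `&` A) (h x)%:E = (\int[mu]_(x in D `&` A) h x)%:E)%E.
Proof.
move=> mD mA ih; have mDA : measurable (D `&` A) by exact: measurableI.
rewrite /Rintegral fineK//; apply: integrable_fin_num; first exact: mDA.
exact: integrable_subset ih.
Qed.

(** The identity of [piece_transfer] is summed over the branches. Asking of [H] only that it be the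
    pointwise limit admits both an abstract limit, for the contraction, and a closed form, for the
    invariant density. *)
Lemma transfer_series n L h H : lipI L h ->
  (forall y, halfI y -> series (fun i => tr (n + i) h y) N @[N --> \oo] --> H y) ->
  forall B, measurable B ->
  \int[mu]_(x in `]0, (tb n)^-1]%classic `&` @fold R @^-1` B) h x =
  \int[mu]_(y in halfI `&` B) H y.
Proof.
move=> lh cH B mB; rewrite /Rintegral; congr fine.
have mfB := measurable_preimage_fold mB.
have mI : measurable (halfI `&` B).
  by apply: measurableI => //; exact: measurable_halfI.
have [M hM] := lipI_bounded lh.
have M0 : 0 <= M.
  by apply: le_trans (hM 0 _); [exact: normr_ge0|apply/halfIP; lra].
rewrite piece_bigcup setI_bigcupl integral_bigcup; first last.
- rewrite -setI_bigcupl -piece_bigcup; apply: (lipI_integrable lh).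
    apply: measurableI => //; exact: measurable_itv.
  move=> x [+ _]; rewrite piece_bigcup => -[i _]; exact: piece_halfI.
- by move=> i; apply: measurableI => //; exact: measurable_piece.
- by apply: trivIset_setIr; exact: trivIset_piece.
have itr i : mu.-integrable (halfI `&` B) (EFin \o tr (n + i) h).
  have [L' lt] := lipI_tr_ex (n + i) lh.
  by apply: (lipI_integrable lt) => //; exact: subIsetl.
have eqN N : (\sum_(0 <= i < N)
     \int[mu]_(x in piece (n + i) `&` @fold R @^-1` B) (h x)%:E =
   \int[mu]_(y in halfI `&` B) (series (fun i => tr (n + i) h y) N)%:E)%E.
  rewrite /series/=; under [RHS]eq_integral do rewrite -sumEFin.
  rewrite integral_sum//.
  apply: eq_bigr => i _.
  rewrite Rintegral_setI_fin//; last 2 first.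
  - exact: measurable_piece.
  - apply: (lipI_integrable lh); first exact: measurable_piece.
    exact: piece_halfI.
  rewrite (piece_transfer _ lh)// -Rintegral_setI_fin//.
  - exact: measurable_halfI.
  - have [L' lt] := lipI_tr_ex (n + i) lh.
    by apply: (lipI_integrable lt) => //; exact: measurable_halfI.
apply/cvg_lim => //; under eq_fun do rewrite eqN.
(* All partial sums are dominated by the constant [M * (4 / 3)], by [tr_bound] and [sum_tb_inv2]. *)
apply: (@dominated_cvg _ _ _ mu _ mI _ _ (EFin \o cst (M * (4 / 3)))).
- move=> N; apply/measurable_EFinP/measurable_sum => i.
  by apply/measurable_EFinP; exact: (measurable_int mu (itr i)).
- move=> x [Ix _]; apply/cvg_EFin; last exact: cH.
  by near=> N.
- by [].
- apply: integrable_within => //.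
  exists (M * (4 / 3)); split; first exact: num_real.
  move=> K MK x _ /=; rewrite ger0_norm ?(ltW MK)// mulr_ge0//; lra.
- move=> N x [Ix _]; rewrite abse_EFin lee_fin /=.
  apply: le_trans (ler_norm_sum _ _ _) _.
  apply: (@le_trans _ _ (\sum_(0 <= i < N) M * tb (n + i) ^- 2)).
    by apply: ler_sum => i _; exact: tr_bound.
  by rewrite -mulr_sumr ler_wpM2l// sum_tb_inv2.
Unshelve. all: by end_near. Qed.

End contraction.

(** * Contraction and mixing *)

Section mixing.
Context {R : realType}.
Local Notation mu := (@lebesgue_measure R).
Implicit Types (x y c d s T L M : R) (h H : R -> R) (A B D : set R).

Lemma fine_mu_halfI : fine (mu halfI) = 1 / 2.
Proof. by rewrite lebesgue_measure_itv/= lte_fin ifT/= ?subr0//; lra. Qed.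

(** On an interval of length 1/2 the function stays within [L / 2] of [h x]; integrating this and
    using that the mean is zero bounds [h x] itself. *)
Lemma mean0_bound L h : lipI L h -> \int[mu]_(x in halfI) h x = 0 ->
  forall x, halfI x -> `|h x| <= L / 2.
Proof.
move=> lh h0 x Ix.
have mI := @measurable_halfI R.
have ih : mu.-integrable halfI (EFin \o h) by exact: (lipI_integrable lh).
have ic (c : R) : mu.-integrable halfI (EFin \o cst c).
  by apply: (@lipI_integrable _ 0) => // p q _ _; rewrite subrr normr0 mul0r.
have near y : halfI y -> h x - L / 2 <= h y <= h x + L / 2.
  move=> Iy; have := lh _ _ Ix Iy; have L0 := lipI_ge0 lh.
  have : L * `|x - y| <= L * (1 / 2).
    rewrite ler_wpM2l//; move: Ix Iy => /halfIP Ix /halfIP Iy.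
    by rewrite ler_norml; lra.
  by rewrite [`|h x - _| <= _]ler_norml; lra.
have lo : \int[mu]_(y in halfI) (h x - L / 2) <= \int[mu]_(y in halfI) h y.
  by apply: le_Rintegral => //; [exact: ic|move=> y /near/andP[]].
have hi : \int[mu]_(y in halfI) h y <= \int[mu]_(y in halfI) (h x + L / 2).
  by apply: le_Rintegral => //; [exact: ic|move=> y /near/andP[]].
move: lo hi; rewrite h0 !Rintegral_cst// fine_mu_halfI => lo hi.
by rewrite ler_norml; lra.
Qed.

Lemma Rintegral_setD1 c D h : measurable D -> mu.-integrable D (EFin \o h) ->
  \int[mu]_(x in D `\ c) h x = \int[mu]_(x in D) h x.
Proof.
move=> mD ih; rewrite /Rintegral.
rewrite [in RHS](@negligible_integral _ _ _ mu D [set c])//.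
exact: lebesgue_measure_set1.
Qed.

(** Since [(tb 0)^-1 = 1/2], the pieces cover [halfI] except for the null point 0. *)
Lemma Rintegral_halfI h A : measurable A -> mu.-integrable halfI (EFin \o h) ->
  \int[mu]_(x in halfI `&` A) h x =
  \int[mu]_(x in `]0, (tb 0)^-1]%classic `&` A) h x.
Proof.
move=> mA ih; have mI := @measurable_halfI R.
have mIA : measurable (halfI `&` A) by exact: measurableI.
rewrite -(@Rintegral_setD1 0)//; last exact: integrable_subset ih.
congr (\int[mu]_(x in _) h x).
have -> : (tb 0)^-1 = 1 / 2 :> R by rewrite /tb; field.
apply/seteqP; rewrite /halfI; split=> x /=; rewrite !in_itv/=.
  by move=> [[/andP[x0 ->] Ax] /eqP xn0]; rewrite lt_neqAle eq_sym xn0 x0.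
move=> [/andP[x0 ->] Ax]; rewrite (ltW x0); split=> // xE.
by rewrite xE ltxx in x0.
Qed.

Lemma transfer_contraction L h : lipI L h -> \int[mu]_(x in halfI) h x = 0 ->
  exists H, [/\ lipI (L / 2) H, \int[mu]_(x in halfI) H x = 0 &
    forall B, measurable B ->
    \int[mu]_(x in halfI `&` @fold R @^-1` B) h x = \int[mu]_(y in halfI `&` B) H y].
Proof.
move=> lh h0; have L0 := lipI_ge0 lh; have hM := mean0_bound lh h0.
pose H y : R := limn (series (fun i => tr i h y)).
(* Absolute convergence, from the bound [L / 2] of [mean0_bound] and [sum_tb_inv2]. *)
have cH y : halfI y -> series (fun i => tr i h y) N @[N --> \oo] --> H y.
  move=> Iy; apply: normed_cvg; apply: nondecreasing_is_cvgn.
    by apply: nondecreasing_series => i _ _; exact: normr_ge0.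
  exists (L / 2 * (4 / 3)) => _ [N _ <-].
  apply: (@le_trans _ _ (\sum_(0 <= i < N) L / 2 * tb (0 + i) ^- 2)).
    by apply: ler_sum => i _; rewrite add0n; exact: tr_bound.
  by rewrite -mulr_sumr ler_wpM2l ?sum_tb_inv2// divr_ge0.
have key B : measurable B ->
    \int[mu]_(x in halfI `&` @fold R @^-1` B) h x = \int[mu]_(y in halfI `&` B) H y.
  move=> mB; rewrite Rintegral_halfI; last 2 first.
  - exact: measurable_preimage_fold.
  - by apply: (lipI_integrable lh) => //; exact: measurable_halfI.
  exact: (transfer_series lh).
exists H; split=> //; last first.
  by have := key setT; rewrite preimage_setT !setIT h0 => <-.
move=> x y Ix Iy.
have cxy : `|series (fun i => tr i h x) N - series (fun i => tr i h y) N|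
    @[N --> \oo] --> `|H x - H y|.
  by apply: cvg_norm; apply: cvgB; exact: cH.
apply: (cvgr_to_le cxy); near=> N.
rewrite /series/= -sumrB; apply: le_trans (ler_norm_sum _ _ _) _.
(* With [M = L / 2] the constant of [lipI_tr] becomes [L (t^-3 + t^-4)], so [sum_tb_inv34] yields
   the factor 1/2. *)
apply: (@le_trans _ _ (\sum_(0 <= i < N) L * `|x - y| * (tb i ^- 3 + tb i ^- 4))).
  apply: ler_sum => i _; apply: le_trans (lipI_tr i lh hM Ix Iy) _.
  have t0 : 0 < tb i :> R by have := @tb_ge2 R i; lra.
  by rewrite le_eqVlt; apply/orP; left; apply/eqP; field; rewrite gt_eqF.
rewrite -mulr_sumr.
have := @sum_tb_inv34 R N; have Lxy : 0 <= L * `|x - y| by rewrite mulr_ge0.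
move=> /(ler_wpM2l Lxy); lra.
Unshelve. all: by end_near. Qed.

Lemma measurable_preimage_iter_fold k B : measurable B ->
  measurable (iter k (@fold R) @^-1` B).
Proof.
move=> mB; elim: k => [//|k mk].
have -> : iter k.+1 (@fold R) @^-1` B = @fold R @^-1` (iter k (@fold R) @^-1` B).
  by apply/funext => x; rewrite /preimage/= -iterSr.
exact: measurable_preimage_fold.
Qed.

(** Each use of [transfer_contraction] trades one iterate of [fold] for a halving of [L]. The base
    case is crude: supremum [L / 2] times length 1/2. *)
Lemma mixing L h k B : lipI L h -> \int[mu]_(x in halfI) h x = 0 ->
  measurable B ->
  `|\int[mu]_(x in halfI `&` iter k (@fold R) @^-1` B) h x| <= L / 2 ^+ k.
Proof.
elim: k L h B => [|k IH] L h B lh h0 mB.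
  have mI := @measurable_halfI R.
  have mIB : measurable (halfI `&` B) by exact: measurableI.
  have ih : mu.-integrable (halfI `&` B) (EFin \o h).
    by apply: (lipI_integrable lh).
  have L0 := lipI_ge0 lh.
  rewrite expr0 divr1; have -> : iter 0 (@fold R) @^-1` B = B by [].
  have nle := @le_normr_Rintegral _ _ R mu _ h mIB ih.
  apply: (le_trans nle).
  have ic : mu.-integrable (halfI `&` B) (EFin \o cst (L / 2)).
    apply: (@lipI_integrable _ 0) => // p q _ _.
    by rewrite subrr normr0 mul0r.
  apply: (@le_trans _ _ (\int[mu]_(x in halfI `&` B) (L / 2))).
    apply: le_Rintegral => //.
      by move: ih => /integrable_norm; rewrite /comp/=.
    by move=> x [Ix _]; exact: (mean0_bound lh).
  rewrite Rintegral_cst//.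
  have : fine (mu (halfI `&` B)) <= fine (mu halfI).
    have fI : mu halfI \is a fin_num.
      by rewrite lebesgue_measure_itv/= lte_fin; case: ifP.
    have le : (mu (halfI `&` B) <= mu halfI)%E.
      by apply: le_measure; rewrite ?inE.
    apply: fine_le => //; rewrite ge0_fin_numE//.
    by apply: le_lt_trans le _; rewrite -ge0_fin_numE.
  rewrite fine_mu_halfI => mle.
  apply: (@le_trans _ _ (L / 2 * (1 / 2))); last lra.
  by rewrite ler_wpM2l// divr_ge0.
have [H [lH H0 eH]] := transfer_contraction lh h0.
have -> : iter k.+1 (@fold R) @^-1` B = @fold R @^-1` (iter k (@fold R) @^-1` B).
  by apply/funext => x; rewrite /preimage/= -iterSr.
rewrite eH; last exact: measurable_preimage_iter_fold.
apply: le_trans (IH _ _ _ lH H0 mB) _.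
by rewrite exprS invfM mulrA.
Qed.

End mixing.

(** * The invariant density *)

Section invariant_density.
Context {R : realType}.
Local Notation mu := (@lebesgue_measure R).
Local Notation G := (@golden R).
Local Notation kap := (1 / ln (@golden R)).
Implicit Types (x y c d s T L M : R) (h H : R -> R) (A B D : set R).

Lemma golden_lt2 : G < 2.
Proof.
have s5 : Num.sqrt 5 ^+ 2 = 5 :> R by rewrite sqr_sqrtr.
have : Num.sqrt 5 < 3 :> R by nra.
by rewrite /golden; lra.
Qed.

Lemma kap_gt0 : 0 < kap.
Proof. by rewrite divr_gt0// ln_golden_gt0. Qed.

(* The density of |x| when x has density rho. *)
Definition rho_fold x : R := kap / (G + x) + kap / (G + 1 - x).

(* The density of fold x when x has density rho_fold on ]0, 1 / tb n]; the
   shift 2 - G is 1 / G^2. *)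
Definition tail_density n y : R :=
  kap / (br n y - (2 - G)) + kap / (br n.+1 y - (2 - G)).

Lemma lipI_inv (b m c s : R) (f : R -> R) : 0 <= b -> 0 < m -> `|s| = 1 ->
  (forall x, f x = c + s * x) ->
  (forall x, halfI x -> m <= f x) -> lipI (b / m ^+ 2) (fun x => b / f x).
Proof.
move=> b0 m0 s1 fE fm x y Ix Iy.
have fx := fm _ Ix; have fy := fm _ Iy.
have fx0 : 0 < f x by lra.
have fy0 : 0 < f y by lra.
have -> : b / f x - b / f y = b * ((f y - f x) * ((f x)^-1 * (f y)^-1)).
  by field; rewrite !gt_eqF.
have -> : f y - f x = s * (y - x) by rewrite !fE; ring.
rewrite !normrM s1 mul1r ger0_norm// [`|y - x|]distrC -mulrA ler_wpM2l//.
rewrite mulrC ler_wpM2r// !gtr0_norm ?invr_gt0// -exprVn expr2.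
by apply: ler_pM; rewrite ?invr_ge0 ?(ltW fx0) ?(ltW fy0)// lef_pV2 ?posrE.
Qed.

Lemma lipID L L' h H : lipI L h -> lipI L' H -> lipI (L + L') (fun x => h x + H x).
Proof.
move=> lh lH x y Ix Iy; rewrite opprD addrACA mulrDl.
by apply: le_trans (ler_normD _ _) _; rewrite lerD// ?lh ?lH.
Qed.

Lemma lipIB L L' c h H : lipI L h -> lipI L' H ->
  lipI (L + `|c| * L') (fun x => h x - c * H x).
Proof.
move=> lh lH x y Ix Iy.
have -> : h x - c * H x - (h y - c * H y) = (h x - h y) - c * (H x - H y) by ring.
rewrite mulrDl; apply: le_trans (ler_normB _ _) _; rewrite lerD ?lh//.
by rewrite normrM -mulrA ler_wpM2l// lH.
Qed.

Lemma lipI_rho_fold : lipI (2 * kap) rho_fold.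
Proof.
have g1 := @golden_gt1 R; have k0 := kap_gt0.
have -> : 2 * kap = kap / 1 ^+ 2 + kap / 1 ^+ 2 by rewrite expr1n !divr1; ring.
apply: lipID.
- apply: (@lipI_inv _ _ G 1); [exact: ltW|by []|by rewrite normr1| |].
    by move=> x; rewrite mul1r.
  by move=> x /halfIP; lra.
- apply: (@lipI_inv _ _ (G + 1) (-1)); [exact: ltW|by []|by rewrite normrN1| |].
    by move=> x; rewrite mulN1r.
  by move=> x /halfIP; lra.
Qed.

(** Both denominators are below 4. The lower bound serves to control Lebesgue integrals by the
    invariant mass in [Rintegral_mass_le]. *)
Lemma rho_fold_ge y : halfI y -> kap / 2 <= rho_fold y.
Proof.
have g1 := @golden_gt1 R; have k0 := kap_gt0; have g2 := golden_lt2.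
move/halfIP => Iy; rewrite /rho_fold.
have H (c : R) : 0 < c -> c <= 4 -> kap / 4 <= kap / c.
  by move=> c0 c4; rewrite ler_pM2l// lef_pV2 ?posrE.
have := H (G + y); have := H (G + 1 - y).
move=> /(_ _ _)/[swap]/(_ _ _) H1 H2.
have : kap / 4 <= kap / (G + y) by apply: H; lra.
have : kap / 4 <= kap / (G + 1 - y) by apply: H; lra.
lra.
Qed.

Lemma br_addn2 n y : br n.+2 y = br n y + 1 :> R.
Proof.
by rewrite /br/= negbK !exprS mulrA mulrNN !mul1r !tbS; case: (odd n); field.
Qed.

(** Partial fractions in [t = br n y], using [1/G = G - 1] and [1/(G + 1) = 2 - G]: the summands of
    [rho_fold] become [kap (1/t - 1/(t + G - 1))] and [kap (1/(t - (2 - G)) - 1/t)]. The terms [1/t]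
    cancel, and [t + G - 1 = (t + 1) - (2 - G)] with [t + 1 = br n.+2 y]. *)
Lemma tr_rho_fold n y : halfI y ->
  tr n rho_fold y = kap / (br n y - (2 - G)) - kap / (br n.+2 y - (2 - G)).
Proof.
move=> Iy; rewrite br_addn2 /tr /rho_fold; have t2 := br_ge2 n Iy.
have g1 := @golden_gt1 R; have g2 := golden_lt2; have gg := @golden_sqr R.
move: (br n y) t2 => t t2; move: (kap) => k.
have gt : 0 < G * t by rewrite mulr_gt0; lra.
have e1 : k / (G + t^-1) * t ^- 2 = k * (t^-1 - (t + G - 1)^-1).
  have -> : (t + G - 1)^-1 = G / (G * t + 1).
    have -> : t + G - 1 = (G * t + 1) / G.
      by field: gg; rewrite gt_eqF; lra.
    by rewrite invf_div.
  by field; rewrite !gt_eqF; lra.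
have e2 : k / (G + 1 - t^-1) * t ^- 2 = k * ((t - (2 - G))^-1 - t^-1).
  have -> : (t - (2 - G))^-1 = (G + 1) / ((G + 1) * t - 1).
    have -> : t - (2 - G) = ((G + 1) * t - 1) / (G + 1).
      field: gg; rewrite gt_eqF; lra.
    by rewrite invf_div.
  by field; rewrite !gt_eqF; nra.
rewrite mulrDl e1 e2.
have -> : t + 1 - (2 - G) = t + G - 1 by ring.
ring.
Qed.

Lemma cvg_tail n y : halfI y ->
  kap / (br (n + N) y - (2 - G)) @[N --> \oo] --> (0 : R).
Proof.
move=> Iy; have g1 := @golden_gt1 R; have k0 := kap_gt0.
apply: (@squeeze_cvgr _ _ _ _ (cst 0) (fun N => 2 * kap * N.+1%:R^-1)).
- near=> N; have := br_itv (n + N) Iy.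
  have n0 : 0 <= n%:R :> R by [].
  have N0 : 0 <= N%:R :> R by [].
  rewrite /tb natrD => /andP[bN _].
  have b0 : 0 < br (n + N) y - (2 - G) by lra.
  apply/andP; split; first by rewrite divr_ge0// ltW.
  have -> : 2 * kap * N.+1%:R^-1 = kap * (2^-1 * N.+1%:R)^-1.
    by rewrite invfM invrK; ring.
  have N1 : N.+1%:R = N%:R + 1 :> R by rewrite natr1.
  by rewrite ler_pM2l// lef_pV2 ?posrE// N1; lra.
- exact: cvg_cst.
- rewrite -[X in _ --> X](mulr0 (2 * kap)); apply: cvgM; first exact: cvg_cst.
  exact: cvg_harmonic.
Unshelve. all: by end_near. Qed.

(** The sum telescopes with step 2, hence two initial terms survive and two final ones vanish in the
    limit. *)
Lemma series_tr_rho_fold n y : halfI y ->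
  series (fun i => tr (n + i) rho_fold y) N @[N --> \oo] --> tail_density n y.
Proof.
move=> Iy; pose a i : R := kap / (br (n + i) y - (2 - G)).
have -> : series (fun i => tr (n + i) rho_fold y) =
    (fun N => tail_density n y - a N - a N.+1).
  apply/funext => N; rewrite /series/=.
  elim: N => [|N IH].
    by rewrite big_geq// /a /tail_density addn0 addn1; ring.
  rewrite big_nat_recr//= IH tr_rho_fold// /a !addnS; ring.
rewrite -[X in _ --> X]subr0 -[X in _ --> X - _]subr0.
apply: cvgB; first by apply: cvgB; [exact: cvg_cst|exact: cvg_tail].
have -> : (fun N => a N.+1) = (fun N => kap / (br (n.+1 + N) y - (2 - G))).
  by apply/funext => N; rewrite /a addnS addSn.
exact: cvg_tail.
Qed.

(** As [br 0 y = 2 + y] and [br 1 y = 3 - y], the transferred density is [rho_fold] again; this is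
    its invariance. *)
Lemma tail_density0 y : tail_density 0 y = rho_fold y.
Proof.
rewrite /tail_density /rho_fold /br /tb/= expr0 expr1.
by congr (_ / _ + _ / _); field.
Qed.

Lemma tail_transfer n B : measurable B ->
  \int[mu]_(x in `]0, (tb n)^-1]%classic `&` @fold R @^-1` B) rho_fold x =
  \int[mu]_(y in halfI `&` B) tail_density n y.
Proof.
exact: (transfer_series lipI_rho_fold (@series_tr_rho_fold n)).
Qed.

Lemma rho_fold_invariant B : measurable B ->
  \int[mu]_(x in halfI `&` @fold R @^-1` B) rho_fold x =
  \int[mu]_(y in halfI `&` B) rho_fold y.
Proof.
move=> mB; rewrite Rintegral_halfI; last 2 first.
- exact: measurable_preimage_fold.
- by apply: (lipI_integrable lipI_rho_fold) => //; exact: measurable_halfI.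
by rewrite tail_transfer//; apply: eq_Rintegral => y _; rewrite tail_density0.
Qed.

(** Every denominator is at least [tb n - 1] because [2 - G < 1]. The constant is quadratic in
    [1 / tb n], whereas [tail_mass] is only of first order, so it is [O(tail_mass)]. *)
Lemma lipI_tail_density n : lipI (2 * kap / (tb n - 1) ^+ 2) (tail_density n).
Proof.
have g1 := @golden_gt1 R; have k0 := kap_gt0; have t2 := @tb_ge2 R n.
have -> : 2 * kap / (tb n - 1) ^+ 2 =
    kap / (tb n - 1) ^+ 2 + kap / (tb n - 1) ^+ 2 by ring.
have H m : (n <= m)%N -> lipI (kap / (tb n - 1) ^+ 2)
    (fun y => kap / (br m y - (2 - G))).
  move=> nm; apply: (@lipI_inv _ _ ((if odd m then tb m.+1 else tb m) - (2 - G))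
    ((-1) ^+ m)); [exact: ltW|lra|by rewrite normrX normrN1 expr1n| |].
    by move=> x; rewrite /br; ring.
  move=> x /(br_itv m) /andP[+ _].
  by have : tb n <= tb m :> R by [rewrite /tb ler_pM2r// lerD2r ler_nat]; lra.
by apply: lipID; exact: H.
Qed.

Lemma tail_density_bound n y : halfI y ->
  2 * kap / (tb n + 1) <= tail_density n y <= 2 * kap / (tb n - 1).
Proof.
have g1 := @golden_gt1 R; have g2 := golden_lt2; have k0 := kap_gt0.
have t2 := @tb_ge2 R n; move=> Iy.
have := br_itv n Iy; have := br_itv n.+1 Iy; rewrite !tbS /tail_density => b1 b2.
have H (c d : R) : 0 < c -> c <= d -> kap / d <= kap / c.
  by move=> c0 cd; rewrite ler_pM2l// lef_pV2 ?posrE//; lra.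
have : kap / (tb n + 1) <= kap / (br n y - (2 - G)) by apply: H; lra.
have : kap / (tb n + 1) <= kap / (br n.+1 y - (2 - G)) by apply: H; lra.
have : kap / (br n y - (2 - G)) <= kap / (tb n - 1) by apply: H; lra.
have : kap / (br n.+1 y - (2 - G)) <= kap / (tb n - 1) by apply: H; lra.
lra.
Qed.

End invariant_density.

(** * Folding the measure onto absolute values *)

Section folding.
Context {R : realType}.
Local Notation mu := (@lebesgue_measure R).
Local Notation G := (@golden R).
Local Notation kap := (1 / ln (@golden R)).
Implicit Types (x y c d s T L M : R) (h H : R -> R) (A B D P : set R).

Lemma ge0_integral_opp D (f : R -> \bar R) : measurable D ->
  measurable_fun D f -> (forall x, D x -> 0 <= f x)%E ->
  (\int[mu]_(x in [set x | D (- x)%R]) f (- x)%R = \int[mu]_(x in D) f x)%E.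
Proof.
move=> mD mf f0.
rewrite (_ : [set x | D (- x)] = (-%R : _ -> measurableTypeR R) @^-1` D)//.
rewrite (_ : (fun x => f (- x)) = f \o (-%R : _ -> measurableTypeR R))//.
rewrite -ge0_integral_pushforward//; last by move=> x; rewrite inE => /f0.
by apply: eq_measure_integral => A mA AS; exact: lebesgue_measureN.
Qed.

(** [X] is cut at 0: the nonnegative half carries the first summand of [rho_fold], and the negative
    half, after reflection, the second. *)
Lemma muN_fold P : measurable P ->
  muN [set x | X x /\ P `|x|] = (\int[mu]_(x in halfI `&` P) rho_fold x)%:E.
Proof.
move=> mP; have g1 := @golden_gt1 R; have k0 := @kap_gt0 R.
have mI := @measurable_halfI R.
have mIP : measurable (halfI `&` P) by exact: measurableI.
pose f1 x := kap / (G + x); pose f2 x := kap / (G + 1 - x).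
have l1 : lipI (kap / 1 ^+ 2) f1.
  apply: (@lipI_inv _ _ _ G 1); [exact: ltW|by []|by rewrite normr1| |].
    by move=> x; rewrite mul1r.
  by move=> x /halfIP; lra.
have l2 : lipI (kap / 1 ^+ 2) f2.
  apply: (@lipI_inv _ _ _ (G + 1) (-1)); [exact: ltW|by []|by rewrite normrN1| |].
    by move=> x; rewrite mulN1r.
  by move=> x /halfIP; lra.
have i1 : mu.-integrable (halfI `&` P) (EFin \o f1) by exact: (lipI_integrable l1).
have i2 : mu.-integrable (halfI `&` P) (EFin \o f2) by exact: (lipI_integrable l2).
(* [X] omits 1/2, and 0 is counted with the nonnegative half only; the removed points are null. *)
pose D1 : set R := (halfI `&` P) `\ (1 / 2).
pose D2 : set R := (halfI `&` P) `\ 0.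
have mD1 : measurable D1 by exact: measurableD.
have mD2 : measurable D2 by exact: measurableD.
have i1' : mu.-integrable D1 (EFin \o f1) by apply: integrable_subset i1 => // x [].
have i2' : mu.-integrable D2 (EFin \o f2) by apply: integrable_subset i2 => // x [].
have -> : [set x | X x /\ P `|x|] = D1 `|` [set x | D2 (- x)].
  have XP x : X x <-> - (1 / 2) <= x < 1 / 2 by rewrite /X/= in_itv.
  apply/seteqP; split=> x.
    move=> [/XP/andP[x1 x2]]; have [x0|x0] := leP 0 x => Px.
      rewrite /= ger0_norm// in Px; left; split; last by move=> /= ?; lra.
      by split=> //; apply/halfIP; lra.
    rewrite /= ltr0_norm// in Px; right; split; last by move=> /= ?; lra.
    by split=> //; apply/halfIP; lra.
  move=> [[[/halfIP x1 Px] /eqP x2]|].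
    rewrite /= ger0_norm; last lra.
    by split=> //; apply/XP; move: x2; rewrite neq_lt => /orP[]; lra.
  rewrite /= => -[[/halfIP x1 Px] /eqP x2].
  have x0 : x < 0 by move: x2; rewrite oppr_eq0 neq_lt => /orP[]; lra.
  by rewrite /= ltr0_norm//; split=> //; apply/XP; lra.
rewrite /muN ge0_integral_setU//; first last.
- apply/disj_setPS => x [[[/halfIP x1 _] _] [[/halfIP x2 _] /= x3]].
  by apply: x3; lra.
- by move=> x _; rewrite lee_fin rho_ge0.
- by apply: measurable_funTS; apply/measurable_EFinP; exact: measurable_rho.
- by rewrite -[X in measurable X]setTI; apply: oppr_measurable.
have -> : (\int[mu]_(x in D1) (rho x)%:E = \int[mu]_(x in D1) (f1 x)%:E)%E.
  apply: eq_integral => x; rewrite inE => -[[/halfIP x1 _] /eqP x2].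
  rewrite /rho ifT; first by rewrite /f1 mulrA mulr1.
  by move: x2; rewrite neq_lt => /orP[]; lra.
have -> : (\int[mu]_(x in [set x | D2 (- x)%R]) (rho x)%:E =
    \int[mu]_(x in D2) (f2 x)%:E)%E.
  rewrite -(@ge0_integral_opp D2)//.
  - apply: eq_integral => x; rewrite inE => -[[/halfIP x1 _] /= x2].
    have x0 : x < 0 by rewrite ltNge; apply/negP => ?; apply: x2; lra.
    rewrite /rho ifF; last by apply/negbTE; lra.
    by rewrite ifT; [rewrite /f2 opprK mulrA mulr1|lra].
  - exact: (measurable_int mu i2').
  - by move=> x [[/halfIP x1 _] _]; rewrite lee_fin divr_ge0//; [exact: ltW|lra].
have fin D h : measurable D -> mu.-integrable D (EFin \o h) ->
    (\int[mu]_(x in D) (h x)%:E = (\int[mu]_(x in D) h x)%:E)%E.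
  by move=> mD ih; rewrite /Rintegral fineK//; exact: integrable_fin_num.
rewrite !fin// !Rintegral_setD1// -EFinD; congr EFin.
by rewrite -RintegralD.
Qed.

Lemma rho_fold_mass1 : \int[mu]_(x in halfI) rho_fold x = 1 :> R.
Proof.
have := muN_fold (@measurableT _ _); rewrite setIT.
have -> : [set x : R | X x /\ setT `|x|] = X by apply/seteqP; split=> [x []|x].
by rewrite muN_X => -[].
Qed.

End folding.

(** * Counting exceedances *)

Section exceedances.
Context {R : realType}.
Local Notation mu := (@lebesgue_measure R).
Local Notation kap := (1 / ln (@golden R)).
Context (n : nat).
Implicit Types (x y c L M : R) (h : R -> R) (A B D U : set R) (N K j : nat).

Let tail : set R := `]0, (tb n)^-1]%classic.

(** The strict inequality at 0 keeps an orbit that has reached 0 from counting as a hit, in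
    agreement with [digit 0 = 0]. *)
Definition hit x := 0 < x <= (tb n)^-1.

Definition hits N x : nat := count (fun i => hit (iter i (@fold R) x)) (iota 0 N).

Definition level N j : set R := [set x | hits N x = j].

(** By [muN_fold] this is the law of [|x|] under [muN]. *)
Definition mass D : R := \int[mu]_(x in halfI `&` D) rho_fold x.

Definition tail_mass : R := \int[mu]_(x in tail) rho_fold x.

Let tailP x : tail x <-> hit x.
Proof. by rewrite /tail/= in_itv. Qed.

Let hitF x : ~ tail x -> hit x = false.
Proof. by move=> tx; apply/negP => /tailP. Qed.

Let measurable_tail : measurable tail.
Proof. exact: measurable_itv. Qed.

Let tail_halfI : tail `<=` halfI.
Proof.
move=> x; rewrite /tail/= in_itv/= => /andP[x0 xt]; apply/halfIP.
have : (tb n)^-1 <= 1 / 2 :> R.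
  by rewrite div1r lef_pV2 ?posrE//; have := @tb_ge2 R n; lra.
lra.
Qed.

Lemma hitsD K N x : hits (K + N) x = (hits K x + hits N (iter K (@fold R) x))%N.
Proof.
rewrite /hits iotaD count_cat add0n -[K in iota K N]addn0 iotaDl count_map.
by congr (_ + _)%N; apply: eq_count => i /=; rewrite addnC iterD.
Qed.

Lemma hitsS N x : hits N.+1 x = (hit x + hits N (fold x))%N.
Proof. by rewrite -add1n hitsD /hits/= addn0. Qed.

Lemma level0 N : level N.+1 0 = ~` tail `&` @fold R @^-1` level N 0.
Proof.
apply/seteqP; split=> x; rewrite /level/= hitsS.
  case: (boolP (hit x)) => [hx|/negP hx]; first by rewrite add1n.
  by rewrite add0n => e; split=> // /tailP.
by move=> [tx e]; rewrite (hitF tx) add0n.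
Qed.

Lemma levelS N j : level N.+1 j.+1 =
  (~` tail `&` @fold R @^-1` level N j.+1) `|` (tail `&` @fold R @^-1` level N j).
Proof.
apply/seteqP; split=> x; rewrite /level/= hitsS.
  case: (boolP (hit x)) => [/tailP tx|/negP hx].
    by rewrite add1n => -[e]; right.
  rewrite add0n => e; left.
  by split=> // /tailP.
by move=> [[tx e]|[/tailP tx e]]; rewrite ?(hitF tx) ?tx ?add0n ?e.
Qed.

Lemma measurable_level N j : measurable (level N j).
Proof.
elim: N j => [|N IH] [|j].
- by have -> : level 0 0 = setT by apply/seteqP; split.
- by have -> : level 0 j.+1 = set0 by apply/seteqP; split.
- rewrite level0; apply: measurableI; first exact: measurableC.
  exact: measurable_preimage_fold.
- rewrite levelS; apply: measurableU; apply: measurableI => //;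
    [exact: measurableC|exact: measurable_preimage_fold|
     exact: measurable_preimage_fold].
Qed.

Let measurable_halfII D : measurable D -> measurable (halfI `&` D : set R).
Proof. by move=> mD; apply: measurableI => //; exact: measurable_halfI. Qed.

Let integrable_halfII L h D : lipI L h -> measurable D ->
  mu.-integrable (halfI `&` D) (EFin \o h).
Proof.
by move=> lh mD; apply: (lipI_integrable lh); [exact: measurable_halfII|].
Qed.

Lemma Rintegral_halfI_split L h D U : lipI L h -> measurable D -> measurable U ->
  \int[mu]_(x in halfI `&` D) h x =
  \int[mu]_(x in halfI `&` (D `&` U)) h x + \int[mu]_(x in halfI `&` (D `&` ~` U)) h x.
Proof.
move=> lh mD mU.
have mDU : measurable (D `&` U) by exact: measurableI.
have mDC : measurable (D `&` ~` U) by apply: measurableI => //; exact: measurableC.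
have e : D = (D `&` U) `|` (D `&` ~` U) by rewrite -setIUr setUv setIT.
rewrite {1}e setIUr Rintegral_setU//; first exact: measurable_halfII.
- exact: measurable_halfII.
- by rewrite -setIUr -e; exact: integrable_halfII lh _.
- rewrite disj_set2E; apply/eqP/seteqP.
  by split=> // x [[_ [_ Ux]] [_ [_ nUx]]]; exact: nUx.
Qed.

Lemma mass_ge0 D : 0 <= mass D.
Proof.
apply: Rintegral_ge0 => x [Ix _]; apply: le_trans (rho_fold_ge Ix).
by rewrite divr_ge0// ltW// kap_gt0.
Qed.

Lemma mass_split D U : measurable D -> measurable U ->
  mass D = mass (D `&` U) + mass (D `&` ~` U).
Proof. by move=> mD mU; exact: Rintegral_halfI_split lipI_rho_fold _ _. Qed.

Lemma mass_setIr D U : measurable D -> measurable U -> mass (D `&` U) <= mass U.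
Proof.
move=> mD mU; rewrite [leRHS](mass_split mU mD) [U `&` D]setIC lerDl.
exact: mass_ge0.
Qed.

Lemma mass_setC D : measurable D -> mass (~` D) = 1 - mass D.
Proof.
move=> mD; have := mass_split (@measurableT _ R) mD.
by rewrite !setTI {1}/mass setIT rho_fold_mass1; lra.
Qed.

Lemma mass_fold D : measurable D -> mass (@fold R @^-1` D) = mass D.
Proof. exact: rho_fold_invariant. Qed.

Lemma mass_tail D : measurable D -> mass (tail `&` @fold R @^-1` D) =
  \int[mu]_(x in halfI `&` D) tail_density n x.
Proof.
move=> mD; rewrite -tail_transfer// /mass setIA; congr (\int[mu]_(x in _ `&` _) _).
exact/setIidPr.
Qed.

Lemma tail_massE : tail_mass = \int[mu]_(x in halfI) tail_density n x.
Proof.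
have := mass_tail measurableT; rewrite preimage_setT !setIT => <-.
by rewrite /mass /tail_mass; congr (\int[mu]_(x in _) _); exact/esym/setIidPr.
Qed.

Lemma tail_mass_bound : kap / (tb n + 1) <= tail_mass <= kap / (tb n - 1).
Proof.
have mI := @measurable_halfI R.
have it : mu.-integrable halfI (EFin \o tail_density n).
  by apply: (lipI_integrable (@lipI_tail_density R n)).
have ic c : mu.-integrable halfI (EFin \o cst c).
  by apply: (@lipI_integrable _ 0) => // p q _ _; rewrite subrr normr0 mul0r.
have bd y : halfI y -> _ := @tail_density_bound R n y.
have lo : \int[mu]_(y in halfI) (2 * kap / (tb n + 1)) <=
    \int[mu]_(y in halfI) tail_density n y.
  by apply: le_Rintegral => //; [exact: ic|move=> y /bd/andP[]].
have hi : \int[mu]_(y in halfI) tail_density n y <=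
    \int[mu]_(y in halfI) (2 * kap / (tb n - 1)).
  by apply: le_Rintegral => //; [exact: ic|move=> y /bd/andP[]].
move: lo hi; rewrite !Rintegral_cst// fine_mu_halfI -tail_massE; lra.
Qed.

Lemma tail_mass_ge0 : 0 <= tail_mass.
Proof.
have /andP[+ _] := tail_mass_bound; apply: le_trans.
by rewrite divr_ge0 ?(ltW (@kap_gt0 R))//; have := @tb_ge2 R n; lra.
Qed.

Lemma mass_level0 N : mass (level N.+1 0) =
  mass (level N 0) - \int[mu]_(x in halfI `&` level N 0) tail_density n x.
Proof.
have mL := measurable_level N 0; have mF := measurable_preimage_fold mL.
rewrite level0 -mass_tail// -(mass_fold mL) (mass_split mF measurable_tail).
by rewrite ![@fold R @^-1` _ `&` _]setIC; lra.
Qed.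

(** Case distinction on the first step. By invariance the preimage of [level N j.+1] under [fold]
    keeps its mass; its part inside the tail is lost, and the part of the preimage of [level N j]
    inside the tail is gained. *)
Lemma mass_levelS N j : mass (level N.+1 j.+1) = mass (level N j.+1)
  - \int[mu]_(x in halfI `&` level N j.+1) tail_density n x
  + \int[mu]_(x in halfI `&` level N j) tail_density n x.
Proof.
have mL := measurable_level N j; have mF := measurable_preimage_fold mL.
have mL' := measurable_level N j.+1; have mF' := measurable_preimage_fold mL'.
have mS := measurable_level N.+1 j.+1.
have e1 : level N.+1 j.+1 `&` tail = tail `&` @fold R @^-1` level N j.
  apply/seteqP; rewrite levelS; split=> x; last by move=> [tx fx]; split=> //; right.
  by move=> [[[ntx _] /ntx//|//]].
have e2 : level N.+1 j.+1 `&` ~` tail = ~` tail `&` @fold R @^-1` level N j.+1.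
  apply/seteqP; rewrite levelS; split=> x; last by move=> [tx fx]; split=> //; left.
  by move=> [[//|[tx _] /(_ tx)]].
rewrite (mass_split mS measurable_tail) e1 e2 -!mass_tail// -(mass_fold mL').
by rewrite (mass_split mF' measurable_tail) ![@fold R @^-1` _ `&` _]setIC; lra.
Qed.

(** The union bound, as by invariance a hit has probability [tail_mass] at every time. *)
Lemma mass_hit_le N : mass (~` level N 0) <= N%:R * tail_mass.
Proof.
rewrite mass_setC; last exact: measurable_level.
elim: N => [|N IH].
  have -> : level 0 0 = setT by apply/seteqP; split.
  by rewrite /mass setIT rho_fold_mass1 subrr mul0r.
rewrite mass_level0 -natr1 mulrDl mul1r.
have mL := measurable_level N 0; have mF := measurable_preimage_fold mL.
suff : \int[mu]_(x in halfI `&` level N 0) tail_density n x <= tail_mass by lra.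
rewrite -mass_tail// setIC; apply: le_trans (mass_setIr mF measurable_tail) _.
by rewrite /mass; have -> : halfI `&` tail = tail by exact/setIidPr.
Qed.

Lemma level_shift K N j x : level K 0 x ->
  level N j x <-> level (N - K) j (iter K (@fold R) x).
Proof.
rewrite /level/= => K0; have [KN|NK] := leqP K N.
  by rewrite -{1}(subnKC KN) hitsD K0.
(* If [K > N] the truncated difference [N - K] is 0 and both counts vanish. *)
have : hits N x = 0%N.
  move: K0; rewrite -(subnKC (ltnW NK)) hitsD => /eqP.
  by rewrite addn_eq0 => /andP[/eqP].
by move=> ->; have -> : (N - K)%N = 0%N by apply/eqP; rewrite subn_eq0 ltnW.
Qed.

Lemma Rintegral_mass_le L h c D : lipI L h -> (forall x, halfI x -> `|h x| <= c) ->
  measurable D -> `|\int[mu]_(x in halfI `&` D) h x| <= 2 * c / kap * mass D.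
Proof.
move=> lh hc mD; have mID := measurable_halfII mD; have k0 := @kap_gt0 R.
have ih := integrable_halfII lh mD.
have ir := integrable_halfII (@lipI_rho_fold R) mD.
have c0 : 0 <= c by apply: le_trans (hc 0 _); [exact: normr_ge0|apply/halfIP; lra].
have nle := @le_normr_Rintegral _ _ R mu _ h mID ih.
apply: (le_trans nle); rewrite /mass -RintegralZl//; apply: le_Rintegral => //.
- by move: ih => /integrable_norm.
- exact: (@integrableZl _ _ _ mu _ mID (2 * c / kap) _ ir).
move=> x [Ix _]; apply: le_trans (hc _ Ix) _.
have cE : c = 2 * c / kap * (kap / 2).
  by field; rewrite gt_eqF// ln_golden_gt0.
rewrite [leLHS]cE; apply: ler_wpM2l; last exact: rho_fold_ge.
by rewrite divr_ge0 ?(ltW k0)// mulr_ge0.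
Qed.

Let density_err x := tail_density n x - tail_mass * rho_fold x.

Lemma density_err_lip : lipI ((6 + 2 * kap) * tail_mass) density_err.
Proof.
have a0 := tail_mass_ge0; have /andP[lo _] := tail_mass_bound.
have k0 := @kap_gt0 R; have t2 := @tb_ge2 R n.
have lip := lipIB tail_mass (@lipI_tail_density R n) (@lipI_rho_fold R).
move=> x y Ix Iy; apply: le_trans (lip _ _ Ix Iy) _.
rewrite ler_wpM2r// ger0_norm//.
(* With [t = tb n] this amounts to [t + 1 <= 3 (t - 1)^2], which holds for [t >= 2] with equality at
   2; hence the constant 6. *)
suff : 2 * kap / (tb n - 1) ^+ 2 <= 6 * tail_mass by lra.
apply: (@le_trans _ _ (6 * (kap / (tb n + 1)))); last by rewrite ler_pM2l.
have -> : 2 * kap / (tb n - 1) ^+ 2 = kap * (2 / (tb n - 1) ^+ 2) by ring.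
have -> : 6 * (kap / (tb n + 1)) = kap * (6 / (tb n + 1)) by ring.
have d0 : 0 < (tb n - 1) ^+ 2 :> R by apply: exprn_gt0; lra.
have d1 : 0 < tb n + 1 :> R by lra.
by rewrite ler_pM2l// ler_pdivrMr// mulrAC ler_pdivlMr// expr2; nra.
Qed.

Lemma density_err_mean0 : \int[mu]_(x in halfI) density_err x = 0.
Proof.
have mI := @measurable_halfI R.
have it : mu.-integrable halfI (EFin \o tail_density n).
  by apply: (lipI_integrable (@lipI_tail_density R n)).
have ir : mu.-integrable halfI (EFin \o rho_fold).
  by apply: (lipI_integrable (@lipI_rho_fold R)).
rewrite RintegralB//; last exact: (@integrableZl _ _ _ mu _ mI tail_mass _ ir).
by rewrite RintegralZl// rho_fold_mass1 mulr1 -tail_massE subrr.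
Qed.

(* A hit followed by [N] steps is almost independent of the hit: skip the first
   [K] steps, which contain no further hit up to mass [K * tail_mass], and use
   mixing for the rest. *)
Lemma hit_decoupling K N j :
  `|\int[mu]_(x in halfI `&` level N j) tail_density n x
    - tail_mass * mass (level N j)| <=
  (6 + 2 * kap) * tail_mass * ((2 ^+ K)^-1 + 2 / kap * (K%:R * tail_mass)).
Proof.
have mL := measurable_level N j; have mIL := measurable_halfII mL.
have -> : \int[mu]_(x in halfI `&` level N j) tail_density n x
    - tail_mass * mass (level N j) = \int[mu]_(x in halfI `&` level N j) density_err x.
  have it := integrable_halfII (@lipI_tail_density R n) mL.
  have ir := integrable_halfII (@lipI_rho_fold R) mL.
  rewrite RintegralB//; last exact: (@integrableZl _ _ _ mu _ mIL tail_mass _ ir).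
  by rewrite RintegralZl.
have lh := density_err_lip; have h0 := density_err_mean0.
set L := (6 + 2 * kap) * tail_mass in lh *.
pose D' := iter K (@fold R) @^-1` level (N - K) j.
have mD' : measurable D'.
  exact: measurable_preimage_iter_fold (measurable_level _ _).
have mK := measurable_level K 0.
have k0 := @kap_gt0 R.
(* Off [level K 0] the supremum [L / 2] of the error, from [mean0_bound], is paired with the mass
   bound [mass_hit_le]. *)
have small D : measurable D ->
    `|\int[mu]_(x in halfI `&` (D `&` ~` level K 0)) density_err x| <=
    L / kap * (K%:R * tail_mass).
  move=> mD; have mDU : measurable (D `&` ~` level K 0).
    by apply: measurableI => //; exact: measurableC.
  have := Rintegral_mass_le lh (mean0_bound lh h0) mDU.
  have -> : 2 * (L / 2) / kap = L / kap by field; rewrite gt_eqF// ln_golden_gt0.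
  move/le_trans; apply; rewrite ler_wpM2l//.
    by rewrite divr_ge0 ?(ltW k0)// (lipI_ge0 lh).
  apply: le_trans (mass_hit_le K); apply: mass_setIr => //; exact: measurableC.
have := mixing K lh h0 (measurable_level (N - K) j).
have := small _ mL; have := small _ mD'.
rewrite (Rintegral_halfI_split lh mL mK) -/D' (Rintegral_halfI_split lh mD' mK).
have -> : D' `&` level K 0 = level N j `&` level K 0.
  by apply/seteqP; split=> x [Dx Kx]; split=> //; apply/(level_shift N j Kx).
(* The integral over [level N j] is [p + q] and that over [D'] is [p + s]; mixing bounds [p + s],
   while [q] and [s] are small. *)
move: (\int[mu]_(x in halfI `&` (level N j `&` level K 0)) _) => p.
move: (\int[mu]_(x in halfI `&` (level N j `&` _)) _) => q.
move: (\int[mu]_(x in halfI `&` (D' `&` _)) _) => s.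
have -> : L * ((2 ^+ K)^-1 + 2 / kap * (K%:R * tail_mass)) =
  L / 2 ^+ K + 2 * (L / kap * (K%:R * tail_mass)) by ring.
by rewrite !ler_norml; lra.
Qed.

End exceedances.

(** * The Poisson limit *)

Section poisson_limit.
Context {R : realType}.
Implicit Types (a : R^nat) (c e l p : R) (m n j : nat).

Definition binomial_mass p n j : R := 'C(n, j)%:R * p ^+ j * (1 - p) ^+ (n - j).

Lemma binomial_mass0 p n : binomial_mass p n 0 = (1 - p) ^+ n.
Proof. by rewrite /binomial_mass bin0 expr0 !mul1r subn0. Qed.

Lemma binomial_massS p n j : binomial_mass p n.+1 j.+1 =
  (1 - p) * binomial_mass p n j.+1 + p * binomial_mass p n j.
Proof.
rewrite /binomial_mass binS natrD subSS; have [nj|jn] := leqP n j.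
  rewrite (bin_small (n := n) (m := j.+1))//.
  by rewrite exprS; ring.
by rewrite -(subnSK jn) !exprS; ring.
Qed.

(** The quotient of consecutive masses converges when [n p] does, which makes an induction on [j]
    possible for the Poisson limit. *)
Lemma binomial_mass_ratio p n j : (j < n)%N -> p != 1 ->
  binomial_mass p n j.+1 =
  binomial_mass p n j * ((n%:R * p - j%:R * p) / (j.+1%:R * (1 - p))).
Proof.
move=> jn p1; rewrite /binomial_mass.
have e : j.+1%:R * 'C(n, j.+1)%:R = (n%:R - j%:R) * 'C(n, j)%:R :> R.
  by rewrite -natrM mul_bin_left natrM natrB// ltnW.
have -> : 'C(n, j.+1)%:R = (n%:R - j%:R) * 'C(n, j)%:R / j.+1%:R :> R.
  by rewrite -e mulrC mulKf// pnatr_eq0.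
rewrite -(subnSK jn) !exprS; field.
by rewrite subr_eq0 eq_sym p1 addrC natr1 pnatr_eq0.
Qed.

Lemma cvg_mean_cvg0 a l : n%:R * a n @[n --> \oo] --> l -> a n @[n --> \oo] --> (0 : R).
Proof.
move=> al; rewrite -cvg_shiftS/=.
have -> : (fun n => a n.+1) = (fun n => n.+1%:R * a n.+1 * n.+1%:R^-1).
  by apply/funext => n; rewrite mulrAC mulfV ?mul1r// pnatr_eq0.
suff H : n.+1%:R * a n.+1 * n.+1%:R^-1 @[n --> \oo] --> l * 0 by rewrite mulr0 in H.
apply: cvgM.
  by rewrite -cvg_shiftS in al.
exact: cvg_harmonic.
Qed.

(** Squeeze by the [n]-th powers of [exp(- a / (1 - a)) <= 1 - a <= exp(- a)]. Both bounds come from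
    [1 + x <= exp x], the lower one through [1 / (1 - a) = 1 + a / (1 - a)]. *)
Lemma binomial_mass0_cvg a l : (forall n, 0 <= a n) ->
  n%:R * a n @[n --> \oo] --> l ->
  binomial_mass (a n) n 0 @[n --> \oo] --> expR (- l).
Proof.
move=> a0 al; have az := cvg_mean_cvg0 al.
have cexp (b : R^nat) c : b n @[n --> \oo] --> c -> expR (b n) @[n --> \oo] --> expR c.
  by move=> bc; apply: cvg_comp bc _; exact: continuous_expR.
apply: (@squeeze_cvgr _ _ _ _ (fun n => expR (- (n%:R * a n) / (1 - a n)))
  (fun n => expR (- (n%:R * a n)))).
- near=> n; have an1 : a n < 1 by near: n; apply: cvgr_lt az _ _.
  have d0 : 0 < 1 - a n by lra.
  rewrite binomial_mass0; apply/andP; split.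
    have -> : - (n%:R * a n) / (1 - a n) = - (a n / (1 - a n)) * n%:R by ring.
    rewrite expRM_natr lerXn2r ?nnegrE ?expR_ge0 ?(ltW d0)//.
    rewrite expRN -[leRHS]invrK lef_pV2 ?posrE ?expR_gt0 ?invr_gt0//.
    apply: le_trans (expR_ge1Dx _).
    by rewrite le_eqVlt; apply/orP; left; apply/eqP; field; rewrite gt_eqF.
  rewrite -mulrN mulrC expRM_natr lerXn2r ?nnegrE ?expR_ge0 ?(ltW d0)//.
  exact: expR_ge1Dx.
- apply: cexp; rewrite -[X in _ --> X]divr1; apply: cvgM; first exact: cvgN.
  apply: cvgV; first exact: oner_neq0.
  by rewrite -[X in _ --> X]subr0; apply: cvgB => //; exact: cvg_cst.
- by apply: cexp; exact: cvgN.
Unshelve. all: by end_near. Qed.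

Lemma binomial_mass_cvg a l j : (forall n, 0 <= a n) ->
  n%:R * a n @[n --> \oo] --> l ->
  binomial_mass (a n) n j @[n --> \oo] --> expR (- l) * (l ^+ j / j`!%:R).
Proof.
move=> a0 al; have az := cvg_mean_cvg0 al.
elim: j => [|j IH].
  by rewrite expr0 fact0 divr1 mulr1; exact: binomial_mass0_cvg.
have -> : expR (- l) * (l ^+ j.+1 / j.+1`!%:R) =
    expR (- l) * (l ^+ j / j`!%:R) * ((l - j%:R * 0) / (j.+1%:R * (1 - 0))).
  have f0 : j`!%:R != 0 :> R by rewrite pnatr_eq0 -lt0n fact_gt0.
  rewrite mulr0 !subr0 mulr1 factS natrM exprS; field.
  by rewrite f0 addrC natr1 pnatr_eq0.
have H : binomial_mass (a n) n j * ((n%:R * a n - j%:R * a n) / (j.+1%:R * (1 - a n)))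
    @[n --> \oo] -->
    expR (- l) * (l ^+ j / j`!%:R) * ((l - j%:R * 0) / (j.+1%:R * (1 - 0))).
  apply: cvgM => //; apply: cvgM.
    by apply: cvgB => //; apply: cvgM => //; exact: cvg_cst.
  apply: cvgV; first by rewrite subr0 mulr1 pnatr_eq0.
  apply: cvgM; first exact: cvg_cst.
  by apply: cvgB => //; exact: cvg_cst.
apply: cvg_trans H; apply: near_eq_cvg; near=> n.
rewrite -binomial_mass_ratio//; first by near: n; exact: nbhs_infty_gt.
by rewrite lt_eqF//; near: n; apply: cvgr_lt az _ _.
Unshelve. all: by end_near. Qed.

End poisson_limit.

(** * Poisson law for the number of hits, and its translation to digits *)

Section hit_counts.
Context {R : realType}.
Local Notation kap := (1 / ln (@golden R)).
Implicit Types (x y r u e : R) (d m n N K j : nat).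

(** The complement of a first hit has nonnegative mass [1 - tail_mass]. This makes the recursion in
    [level_binomial] a convex combination. *)
Lemma tail_mass_le1 d : tail_mass d <= 1 :> R.
Proof.
have := @mass_level0 R d 0.
have -> : level d 0 0 = setT :> set R by apply/seteqP; split.
rewrite setIT -tail_massE /mass setIT rho_fold_mass1.
by have := mass_ge0 (level d 1 0 : set R); rewrite /mass; lra.
Qed.

(** Both sides obey the same recursion up to two decoupling errors. Convex combinations do not
    amplify earlier errors, so each step adds at most [2 * e]. *)
Lemma level_binomial d e N j :
  (forall N j, `|\int[lebesgue_measure]_(x in halfI `&` level d N j) tail_density d x
    - tail_mass d * mass (level d N j)| <= e) ->
  `|mass (level d N j) - binomial_mass (tail_mass d) N j| <= N%:R * (2 * e).
Proof.
have a0 := @tail_mass_ge0 R d; have a1 := tail_mass_le1 d => dec.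
have e0 : 0 <= e by apply: le_trans (dec 0%N 0%N); exact: normr_ge0.
move: (tail_mass d) a0 a1 dec => a a0 a1 dec.
elim: N j => [|N IH] [|j].
- have -> : level d 0 0 = setT :> set R by apply/seteqP; split.
  by rewrite binomial_mass0 /mass setIT rho_fold_mass1 subrr normr0 mul0r.
- have -> : level d 0 j.+1 = set0 :> set R by apply/seteqP; split.
  rewrite /mass setI0 Rintegral_set0 /binomial_mass bin0n !mul0r.
  by rewrite subrr normr0.
- rewrite mass_level0 binomial_mass0 exprS -binomial_mass0 -natr1.
  have := dec N 0%N; have := IH 0%N.
  move: (mass _) (binomial_mass _ _ _) (Rintegral _ _ _) => p b v.
  move=> pb vp.
  have -> : p - v - (1 - a) * b = (1 - a) * (p - b) - (v - a * p) by ring.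
  apply: le_trans (ler_normB _ _) _; rewrite normrM ger0_norm; last lra.
  have : (1 - a) * `|p - b| <= 1 * `|p - b| by rewrite ler_wpM2r//; lra.
  lra.
- rewrite mass_levelS binomial_massS -natr1.
  have := dec N j.+1; have := dec N j; have := IH j.+1; have := IH j.
  move: (mass (level d N j)) (mass (level d N j.+1)) => p p'.
  move: (\int[lebesgue_measure]_(x in halfI `&` level d N j) tail_density d x) => v.
  move: (\int[lebesgue_measure]_(x in _) _) => v'.
  move: (binomial_mass a N j) (binomial_mass a N j.+1) => b b'.
  move=> pb pb' vp vp'.
  have -> : p' - v' + v - ((1 - a) * b' + a * b) =
     (1 - a) * (p' - b') + a * (p - b) + ((v - a * p) - (v' - a * p')) by ring.
  apply: le_trans (ler_normD _ _) _.
  have := ler_normB (v - a * p) (v' - a * p').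
  have := ler_normD ((1 - a) * (p' - b')) (a * (p - b)).
  rewrite !normrM (ger0_norm a0) [`|1 - a|]ger0_norm; last lra.
  have : (1 - a) * `|p' - b'| <= (1 - a) * (N%:R * (2 * e)) by rewrite ler_wpM2l//; lra.
  have : a * `|p - b| <= a * (N%:R * (2 * e)) by rewrite ler_wpM2l.
  lra.
Qed.

(** The accumulated error is [n a] times a constant times [2^-K + (2 / kap) K a]. As [n a] converges
    and [a] tends to 0, for fixed [K] its limit is of order [2^-K]; so [K] is chosen first and [n]
    afterwards. *)
Lemma level_poisson (d : nat -> nat) (l : R) j :
  n%:R * tail_mass (d n) @[n --> \oo] --> l ->
  mass (level (d n) n j) @[n --> \oo] --> expR (- l) * (l ^+ j / j`!%:R).
Proof.
move=> al; pose a n : R := tail_mass (d n).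
have a0 n : 0 <= a n by exact: tail_mass_ge0.
have az := cvg_mean_cvg0 al.
have bl := @binomial_mass_cvg R a l j a0 al.
rewrite -[X in _ --> X]add0r.
have -> : (fun n => mass (level (d n) n j)) = (fun n =>
    (mass (level (d n) n j) - binomial_mass (a n) n j) + binomial_mass (a n) n j).
  by apply/funext => n; rewrite subrK.
apply: cvgD => //; apply/cvgr0Pnorm_lt => e e0.
pose C : R := 2 * (6 + 2 * kap).
have [K Ke] : exists K, l * (C * ((2 ^+ K)^-1 + 2 / kap * (K%:R * 0))) < e.
  have g : l * C * 2^-1 ^+ K @[K --> \oo] --> l * C * 0.
    by apply: cvgM; [exact: cvg_cst|apply: cvg_expr; rewrite ger0_norm; lra].
  have : \forall K \near \oo, l * C * 2^-1 ^+ K < e.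
    by apply: cvgr_lt g _ _; rewrite mulr0.
  move=> [K _ /(_ K (leqnn K)) /= Ke]; exists K.
  by rewrite !mulr0 addr0 mulrA -exprVn.
have lim : n%:R * a n * (C * ((2 ^+ K)^-1 + 2 / kap * (K%:R * a n))) @[n --> \oo] -->
    l * (C * ((2 ^+ K)^-1 + 2 / kap * (K%:R * 0))).
  apply: cvgM => //; apply: cvgM; first exact: cvg_cst.
  apply: cvgD; first exact: cvg_cst.
  apply: cvgM; first exact: cvg_cst.
  by apply: cvgM => //; exact: cvg_cst.
near=> n; apply: le_lt_trans (level_binomial n j (@hit_decoupling R (d n) K)) _.
have -> : n%:R * (2 * ((6 + 2 * kap) * tail_mass (d n) *
    ((2 ^+ K)^-1 + 2 / kap * (K%:R * tail_mass (d n))))) =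
    n%:R * a n * (C * ((2 ^+ K)^-1 + 2 / kap * (K%:R * a n))) by rewrite /C /a; ring.
by near: n; exact: cvgr_lt lim _ Ke.
Unshelve. all: by end_near. Qed.

Lemma b1_abs x : b1 x = digit `|x|.
Proof.
rewrite /b1 /digit; have [->|x0] := eqVneq x 0.
  by rewrite sgr0 normr0 mul0r invr0.
congr (Num.floor (_ + _)).
by rewrite {2}[x]numEsg invfM invr_sg mulrA -expr2 sqr_sg x0 mul1r.
Qed.

Lemma digit0 : digit (0 : R) = 0.
Proof. by apply: floor_def; rewrite invr0 add0r; lra. Qed.

Lemma TN_abs x : `|TN x| = fold `|x|.
Proof.
rewrite /TN; case: eqVneq => [->|x0].
  by rewrite /fold normr0 digit0 invr0 subr0 normr0.
rewrite /fold -b1_abs /b1; congr `|_ - _|.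
by rewrite {2}[x]numEsg invfM invr_sg mulrA -expr2 sqr_sg x0 mul1r.
Qed.

Lemma iter_TN_abs i x : `|iter i (@TN R) x| = iter i (@fold R) `|x|.
Proof. by elim: i => [//|i IH]; rewrite !iterS TN_abs IH. Qed.

Lemma X_abs x : X x -> halfI `|x|.
Proof.
rewrite /X/= in_itv/= => /andP[x1 x2]; apply/halfIP; rewrite normr_ge0/=.
by rewrite ler_norml; lra.
Qed.

Lemma iter_fold_halfI i x : X x -> halfI (iter i (@fold R) `|x|).
Proof.
move=> Xx; rewrite -iter_TN_abs; apply: X_abs.
by case: i => [//|i]; rewrite iterS; exact: TN_X.
Qed.

(** For [y > 0], an integer digit exceeds [u] iff it is at least [m + 1], that is iff
    [y^-1 + 1/2 >= m + 1], or [y^-1 >= tb d]. *)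
Lemma hit_digit u d m y : m%:R <= u < m.+1%:R -> tb d = m%:R + 1 / 2 :> R ->
  halfI y -> hit d y = (u < (digit y)%:~R).
Proof.
move=> mu dm /halfIP Iy; rewrite /hit.
have u0 : 0 <= u by apply: (@le_trans _ _ m%:R) => //; lra.
have [->|y0] := eqVneq y 0.
  by rewrite ltxx digit0/=; apply/esym/negbTE; rewrite -leNgt.
have y1 : 0 < y by lra.
have t2 := @tb_ge2 R d.
rewrite y1/= -[y in LHS]invrK lef_pV2 ?posrE ?invr_gt0//; last lra.
rewrite dm; transitivity ((m.+1%:Z <= digit y)%R).
  rewrite /digit floor_ge_int -pmulrn -[m.+1%:R]natr1.
  by apply/idP/idP; lra.
apply/idP/idP => [my|uy].
  apply: (@lt_le_trans _ _ m.+1%:R); first by lra.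
  by rewrite pmulrn ler_int.
rewrite -[m.+1%:Z]/(1 + m%:Z) addrC lezD1 -(ltr_int R) -pmulrn; lra.
Qed.

Lemma Sn_hits N u d m x : m%:R <= u < m.+1%:R -> tb d = m%:R + 1 / 2 :> R ->
  X x -> Sn N x u = hits d N `|x|.
Proof.
(* Digits are numbered from 1 and hits from 0; the predecessor in [bn] absorbs the shift. *)
move=> mu dm Xx; rewrite /Sn /hits -[1%N]addn0 iotaDl count_map.
apply: eq_count => i /=; rewrite (hit_digit mu dm); last exact: iter_fold_halfI.
by rewrite /bn add1n/= b1_abs iter_TN_abs.
Qed.

Lemma Sn_level N u d m j : m%:R <= u < m.+1%:R -> tb d = m%:R + 1 / 2 :> R ->
  muN [set x : R | X x /\ Sn N x u = j] = (mass (level d N j))%:E.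
Proof.
move=> mu dm; rewrite -muN_fold; last exact: measurable_level.
congr muN; apply/seteqP; split=> x [Xx] /=.
  by rewrite (Sn_hits _ mu dm Xx).
by rewrite /level/= -(Sn_hits _ mu dm Xx).
Qed.

End hit_counts.

(** * Asymptotics of the mean number of hits *)

Section tail_asymptotics.
Context {R : realType}.
Local Notation kap := (1 / ln (@golden R)).
Implicit Types (r c : R).

Lemma unE n r : un n r = n%:R * (r * kap).
Proof. by rewrite /un; ring. Qed.

Lemma un_itv n r : 0 < r ->
  (Num.truncn (un n r))%:R <= un n r < (Num.truncn (un n r)).+1%:R.
Proof.
move=> r0; apply: truncn_itv.
by rewrite unE mulr_ge0// mulr_ge0 ?ltW//; exact: kap_gt0.
Qed.

Lemma un_cvg r c : 0 < r -> un n r + c @[n --> \oo] --> +oo.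
Proof.
move=> r0; have c0 : 0 < r * kap by rewrite mulr_gt0// kap_gt0.
apply/cvgryPge => A; near=> n.
rewrite unE -lerBlDr -ler_pdivrMr//.
by near: n; exact: nbhs_infty_ger.
Unshelve. all: by end_near. Qed.

Lemma un_large r : 0 < r -> \forall n \near \oo, 2 <= un n r.
Proof.
by move=> /(un_cvg 0); under eq_fun do rewrite addr0; move/cvgryPge => /(_ 2).
Qed.

(* The index of the tail ]0, 1 / (m + 1 / 2)] on which the digit exceeds u, where
   m is the integer part of u. *)
Definition tail_index (u : R) : nat := ((Num.truncn u).*2 - 3)%N.

Lemma tb_tail_index r : 0 < r -> \forall n \near \oo,
  tb (tail_index (un n r)) = (Num.truncn (un n r))%:R + 1 / 2 :> R.
Proof.
move=> r0; near=> n; have : 2 <= un n r by near: n; exact: un_large.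
have /andP[_ m2] := un_itv n r0.
move=> /le_lt_trans => /(_ _ m2); rewrite ltr_nat ltnS => m2'.
(* The integer part is at least 2, so subtracting 3 from its double does not truncate. *)
rewrite /tb /tail_index natrB; last by lia.
by rewrite -mul2n natrM; field.
Unshelve. all: by end_near. Qed.

(** Since [n * kap = un n r / r], the quantity is [(1 - c / (un n r + c)) / r]. *)
Lemma un_ratio_cvg r c : 0 < r ->
  n%:R * (kap / (un n r + c)) @[n --> \oo] --> 1 / r.
Proof.
move=> r0; have k0 := @kap_gt0 R.
have up : \forall n \near \oo, 0 < un n r + c.
  by have /cvgryPgt/(_ 0) := un_cvg c r0.
have H : (1 - c * (un n r + c)^-1) * r^-1 @[n --> \oo] --> (1 - c * 0) * r^-1.
  apply: cvgM; last exact: cvg_cst.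
  apply: cvgB; first exact: cvg_cst.
  apply: cvgM; first exact: cvg_cst.
  by rewrite gtr0_cvgV0//; exact: un_cvg.
rewrite mulr0 subr0 in H; apply: cvg_trans H; apply: near_eq_cvg; near=> n.
have u0 : 0 < un n r + c by near: n; exact: up.
have -> : 1 - c * (un n r + c)^-1 = un n r / (un n r + c).
  by field; rewrite gt_eqF.
move: (un n r + c) u0 => w w0; rewrite unE.
by field; rewrite !gt_eqF// ln_golden_gt0.
Unshelve. all: by end_near. Qed.

(** With [u = un n r] and [m] its integer part, [tail_mass_bound] places the mass between
    [kap / (m + 3/2)] and [kap / (m - 1/2)]. As [u - 1 < m <= u], the shifts [3/2] and [-3/2] of [u]
    enclose it. *)
Lemma mean_hits_cvg r : 0 < r ->
  n%:R * tail_mass (tail_index (un n r)) @[n --> \oo] --> 1 / r.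
Proof.
move=> r0; have k0 := @kap_gt0 R.
have H c : n%:R * (kap / (un n r + c)) @[n --> \oo] --> 1 / r.
  exact: un_ratio_cvg.
apply: (@squeeze_cvgr _ _ _ _ (fun n => n%:R * (kap / (un n r + 3 / 2)))
  (fun n => n%:R * (kap / (un n r + - (3 / 2))))) => //.
near=> n; have u2 : 2 <= un n r by near: n; exact: un_large.
have tbE : tb (tail_index (un n r)) = (Num.truncn (un n r))%:R + 1 / 2 :> R.
  by near: n; exact: tb_tail_index.
have := @tail_mass_bound R (tail_index (un n r)); rewrite tbE => /andP[lo hi].
have := un_itv n r0; rewrite -[X in _ < X]natr1 => mu.
apply/andP; split; apply: ler_wpM2l => //.
  by apply: le_trans lo; rewrite ler_pM2l// lef_pV2 ?posrE; lra.
by apply: (le_trans hi); rewrite ler_pM2l// lef_pV2 ?posrE; lra.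
Unshelve. all: by end_near. Qed.

End tail_asymptotics.

Theorem theorem1p4 (R : realType) (r : R) (j : nat) : 0 < r ->
  muN [set x : R | X x /\ Sn n x (un n r) = j] @[n --> \oo] -->
    (expR (- (1 / r)) * (r ^- j / j`!%:R))%:E.
Proof.
move=> r0; have -> : r ^- j = (1 / r) ^+ j by rewrite div1r exprVn.
have H : (mass (level (tail_index (un n r)) n j))%:E @[n --> \oo] -->
    (expR (- (1 / r)) * ((1 / r) ^+ j / j`!%:R))%:E.
  apply/cvg_EFin; first by near=> n.
  exact: (@level_poisson R (fun n => tail_index (un n r)) _ j (mean_hits_cvg r0)).
(* The sets coincide with levels only once [n] is large enough for [tb_tail_index], which suffices
   for the limit. *)
apply: cvg_trans H; apply: near_eq_cvg; near=> n.
apply/esym/(Sn_level _ _ (un_itv n r0)).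
by near: n; exact: tb_tail_index.
Unshelve. all: by end_near. Qed.
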